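(* Let $(A,W)$ be a 1-Schur pair and $S$ a Sato operator of $W$. Then: (1) for every $f\in A$ there is a unique operator $\mathtt L_S(f)\in\hat D_n^{sym}$ with $S\circ f=\mathtt L_S(f)\circ S$, and $\mathbf{ord}(\mathtt L_S(f))=\mathbf{ord}(f)$; (2) the map $A\to\hat D_n^{sym}$, $f\mapsto\mathtt L_S(f)$, is an injective homomorphism of $K$-algebras.
   Context: Let $K$ be a field of characteristic $0$, $n\ge1$, $m\ge0$, $K_y:=K[[y_1,\dots,y_m]]$ ($K_y=K$ if $m=0$), $\hat R_y:=K_y[[x_1,\dots,x_n]]$ with maximal ideal $\mathfrak m=(y_1,\dots,y_m,x_1,\dots,x_n)$ and $\mathfrak m$-adic order $\upsilon$. For a formal series $P=\sum_{\underline k}a_{\underline k}\underline\partial^{\underline k}$ ($a_{\underline k}\in\hat R_y$) put $\mathbf{ord}(P)=\sup_{\underline k}(|\underline k|-\upsilon(a_{\underline k}))$; $\hat D_n^{sym}$ is the ring of such series with $\mathbf{ord}<\infty$ (Leibniz rule, $\partial_i=\partial/\partial x_i$, $y_j$ central). Highest symbol $\sigma(P)$: sum of the terms $\alpha\,\underline z^{\underline i}\underline\partial^{\underline k}$ ($\underline z^{\underline i}$ monomial in $x$'s and $y$'s) with $|\underline k|-|\underline i|=\mathbf{ord}(P)$. $\bar a:=a|_{y=0}$. $\hat D_n^n$: operators not involving $\partial_n$; $\hat E_n:=\hat D_n^n((\partial_n^{-1}))$ (multiplication $\partial_n^s a=\sum_{j\ge0}\binom{s}{j}\partial_n^j(a)\partial_n^{s-j}$),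 $\Pi_n=\{P\in\hat E_n:\mathbf{ord}(P)<\infty\}$. $\hat\Pi_n$: series $\sum_{i\in\mathbb Z}a_i\partial_n^i$ ($a_i\in\hat D_n^n$) with $\mathbf{ord}<\infty$; a $(\hat D_n^{sym},\Pi_n)$-bimodule with products $\circ$ (associative). $V_n:=K_y\{\{\partial_1,\dots,\partial_{n-1}\}\}((\partial_n^{-1}))$ with $K_y\{\{\partial_1,\dots,\partial_{n-1}\}\}=K_y[[\partial_1,\dots,\partial_{n-1}]]\cap\hat D_n^n$ (a commutative ring); $F:=K_y[[\partial_1,\dots,\partial_n]]\cap\Pi_n$. Each $P\in\hat\Pi_n$ has a unique slice decomposition $P=\sum_{\underline i\in\mathbb N_0^n}\frac{\underline x^{\underline i}}{\underline i!}P_{(\underline i)}$, $P_{(\underline i)}\in V_n$; for $\underline k\in\mathbb N_0^{n-1}\times\mathbb Z$, $\underline\partial^{\underline k}\diamond P:=\sum_{\underline i}\binom{\underline k}{\underline i}\underline\partial^{\underline k-\underline i}P_{(\underline i)}$ (i.e. $\underline\partial^{\underline k}\circ P$ modulo $(x_1,\dots,x_n)$), extended $K_y$-linearly and continuously to $f\diamond P$, $f\in V_n$. $P$ is regular if $f\mapsto f\diamond\sigma(P)$, $F\to V_n$, is injective. For $0\neq a=\sum a_{\underline i}\underline\partial^{\underline i}\in V_n$, $\mathrm{ord}_\Gamma(a)$ is the anti-lexicographically largest $\underline i$ with $a_{\underline i}\neq0$ and $LT(a)=\bar a_{\mathrm{ord}_\Gamma(a)}\underline\partial^{\mathrm{ord}_\Gamma(a)}$;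 $\mathrm{Supp}(W)$ is the $K_y$-span of $LT(a)$, $a\in W$. $W\subseteq V_n\cap\Pi_n$ is a 1-space if it has a basis $\{w_k\}$ with $\{\bar w_k\}$ a basis of $\mathrm{Supp}(W)$. $W_k=\{w\in W:\mathbf{ord}(w)\le k\}$, $H_W(k)=\dim_K\bar W_k$; $\mathrm{Gr}_\mu(V_n)$: 1-spaces with $H_W(\mu+k)=\binom{n+k}{n}$ for all $k\in\mathbb Z$. A Sato operator of $W\in\mathrm{Gr}_\mu(V_n)$ is a regular $S\in\hat\Pi_n$ with $\mathbf{ord}(S)=\mu$ and $W=F\diamond S$. A 1-Schur pair is a pair $(A,W)$ of 1-spaces in $V_n$ with $A$ a $K$-subalgebra with $1$, $W\cdot A\subseteq W$, and $W\in\mathrm{Gr}_\mu(V_n)$ for some $\mu\in\mathbb Z$. *)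

(* Defs.v *)
From HB Require Import structures.
From mathcomp Require Import all_boot all_order all_algebra.
From mathcomp Require Import boolp classical_sets functions cardinality fsbigop.

Set Implicit Arguments.
Unset Strict Implicit.
Unset Printing Implicit Defensive.

Import Order.TTheory GRing.Theory Num.Theory.
Local Open Scope classical_set_scope.
Local Open Scope ring_scope.

(*   K_y = K[[y_1..y_m]],  R_y = K_y[[x_1..x_n]]                              *)
(* A power series a in R_y is a function  mon -> K  where a monomial exponent *)
(* e = (e.1, e.2) stands for  y^e.1 x^e.2.                                    *)
(* An operator  sum_k a_k d^k  is a function  didx -> ps,  k in Z^n; the last *)
(* coordinate (index n-1) is the exponent of d_n.                             *)

Section Operators.
Variables (K : fieldType) (m n : nat).

Definition mon := ({ffun 'I_m -> nat} * {ffun 'I_n -> nat})%type.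
Definition didx := {ffun 'I_n -> int}.
Definition pdidx := {ffun 'I_n -> nat}.
Definition ps := mon -> K.
Definition op := didx -> ps.

Definition degm (e : mon) : nat := (\sum_i e.1 i + \sum_i e.2 i)%N.
Definition absk (k : didx) : int := \sum_i k i.

Definition lemon (u e : mon) : bool :=
  [forall i, u.1 i <= e.1 i]%N && [forall i, u.2 i <= e.2 i]%N.
Definition submon (e u : mon) : mon :=
  ([ffun i => e.1 i - u.1 i]%N, [ffun i => e.2 i - u.2 i]%N).

Definition psmul (a b : ps) : ps :=
  fun e => \sum_(u \in [set u | lemon u e]) a u * b (submon e u).

Definition psone : ps := fun e => if degm e == 0%N then 1 else 0.

(* d^j a  for j in N^n  (derivative in the x-variables) *)
Definition dpow (j : pdidx) (a : ps) : ps :=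
  fun e => (\prod_i ((e.2 i + j i) ^_ (j i))%:R) *
           a (e.1, [ffun i => (e.2 i + j i)%N]).

Definition binz (s : int) (j : nat) : K :=
  (\prod_(t < j) (s - t%:Z)%:~R) / (j`!)%:R.
Definition binzm (k : didx) (j : pdidx) : K := \prod_i binz (k i) (j i).

(* composition of operators (generalized Leibniz rule):
   (P o Q)_r = sum_{k, j} binom(k,j) P_k d^j(Q_{r-k+j}),
   a finitely supported sum coefficientwise (m-adic convergence) *)
Definition opmul (P Q : op) : op :=
  fun r e => \sum_(p \in [set: didx * pdidx])
     (binzm p.1 p.2 *
      psmul (P p.1) (dpow p.2 (Q [ffun i => r i - p.1 i + (p.2 i)%:Z])) e).

Definition opone : op := fun k e => if k == [ffun=> 0%:Z] then psone e else 0.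
Definition opzero : op := fun _ _ => 0.
Definition opadd (P Q : op) : op := fun k e => P k e + Q k e.
Definition opscale (c : K) (P : op) : op := fun k e => c * P k e.

(* ord(P) <= B,  ord(P) = sup_k (|k| - v(a_k)) *)
Definition ord_le (P : op) (B : int) : Prop :=
  forall (k : didx) (e : mon), P k e != 0 -> absk k - (degm e)%:Z <= B.
Definition ord_eq (P : op) (mu : int) : Prop := ord_le P mu /\ ~ ord_le P (mu - 1).
Definition ord_fin (P : op) : Prop := exists B, ord_le P B.

Definition is_last (i : 'I_n) : bool := (val i).+1 == n.

Definition is_Dsym (P : op) : Prop :=
  (forall k : didx, (exists i, k i < 0) -> P k = 0) /\ ord_fin P.
(* \hat Pi_n : series in d_n (all integer powers) with coefficients in D_n^n *)
Definition is_hatPi (P : op) : Prop :=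
  (forall k : didx, (exists i, ~~ is_last i /\ k i < 0) -> P k = 0) /\ ord_fin P.
(* Pi_n = { P in D_n^n((d_n^{-1})) : ord P < oo } *)
Definition is_Pi (P : op) : Prop :=
  is_hatPi P /\ exists N : int, forall (k : didx) i, is_last i -> N < k i -> P k = 0.
Definition const_coef (P : op) : Prop :=
  forall (k : didx) (e : mon), e.2 != [ffun=> 0%N] -> P k e = 0.
Definition in_VPi (P : op) : Prop := is_Pi P /\ const_coef P.
(* F = K_y[[d_1..d_n]] cap Pi_n *)
Definition in_F (P : op) : Prop :=
  in_VPi P /\ (forall k : didx, (exists i, k i < 0) -> P k = 0).

Definition is_Ky (c : ps) : Prop := forall e : mon, e.2 != [ffun=> 0%N] -> c e = 0.
Definition kyscale (c : ps) (P : op) : op := fun k => psmul c (P k).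

Definition opbar (P : op) : op :=
  fun k e => if e.1 == [ffun=> 0%N] then P k e else 0.

(* highest symbol of P, where mu = ord(P) *)
Definition sigma (P : op) (mu : int) : op :=
  fun k e => if absk k - (degm e)%:Z == mu then P k e else 0.

Definition diamond (f P : op) : op :=
  fun r e => if e.2 == [ffun=> 0%N] then opmul f P r e else 0.

Definition regular (P : op) (mu : int) : Prop :=
  forall f g, in_F f -> in_F g ->
    diamond f (sigma P mu) = diamond g (sigma P mu) -> f = g.

Definition antilex_le (k i : didx) : Prop :=
  k = i \/ exists j : 'I_n, k j < i j /\ forall l : 'I_n, (j < l)%N -> k l = i l.

Definition is_ordG (a : op) (i : didx) : Prop :=
  a i <> (fun _ => 0) /\ forall k : didx, a k <> (fun _ => 0) -> antilex_le k i.

Definition is_LT (a L : op) : Prop :=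
  exists i, is_ordG a i /\ L = (fun k e => if k == i then opbar a i e else 0).

Definition Supp (W : set op) : set op :=
  [set P | exists s : seq (ps * op),
     (forall p, p \in s -> is_Ky p.1 /\ exists a, W a /\ is_LT a p.2) /\
     P = foldr (fun p acc => opadd (kyscale p.1 p.2) acc) opzero s].

(* infinite (m-adically convergent) sums of operators *)
Definition summable (T : choiceType) (F : T -> op) : Prop :=
  forall r e, finite_set [set t | F t r e != 0].
Definition opsum (T : choiceType) (F : T -> op) : op :=
  fun r e => \sum_(t \in [set: T]) F t r e.

Definition is_basis (X : set op) (T : choiceType) (w : T -> op) : Prop :=
  (forall t, X (w t)) /\
  (forall a, X a -> exists c : T -> ps, (forall t, is_Ky (c t)) /\
      summable (fun t => kyscale (c t) (w t)) /\
      a = opsum (fun t => kyscale (c t) (w t))) /\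
  (forall c c' : T -> ps, (forall t, is_Ky (c t)) -> (forall t, is_Ky (c' t)) ->
      summable (fun t => kyscale (c t) (w t)) ->
      summable (fun t => kyscale (c' t) (w t)) ->
      opsum (fun t => kyscale (c t) (w t)) = opsum (fun t => kyscale (c' t) (w t)) ->
      c = c').

Definition one_space (W : set op) : Prop :=
  (forall a, W a -> in_VPi a) /\
  exists (T : choiceType) (w : T -> op),
    is_basis W w /\ is_basis (Supp W) (fun t => opbar (w t)).

Definition dimK (X : set op) (d : nat) : Prop :=
  exists v : 'I_d -> op, (forall i, X (v i)) /\
    (forall c : 'I_d -> K,
       foldr (fun i acc => opadd (opscale (c i) (v i)) acc) opzero (enum 'I_d)
         = opzero -> forall i, c i = 0) /\
    (forall x, X x -> exists c : 'I_d -> K,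
       x = foldr (fun i acc => opadd (opscale (c i) (v i)) acc) opzero (enum 'I_d)).

Definition Wk (W : set op) (k : int) : set op := [set w | W w /\ ord_le w k].
Definition H_eq (W : set op) (k : int) (d : nat) : Prop :=
  dimK [set opbar w | w in Wk W k] d.

Definition binnk (k : int) : nat :=
  match k with Posz k' => 'C(n + k', n) | Negz _ => 0%N end.

Definition in_Gr (mu : int) (W : set op) : Prop :=
  one_space W /\ forall k : int, H_eq W (mu + k) (binnk k).

Definition subalg (A : set op) : Prop :=
  A opone /\ (forall f g, A f -> A g -> A (opadd f g)) /\
  (forall c f, A f -> A (opscale c f)) /\
  (forall f g, A f -> A g -> A (opmul f g)).

Definition schur_pair (A W : set op) : Prop :=
  one_space A /\ one_space W /\ subalg A /\
  (forall w a, W w -> A a -> W (opmul w a)) /\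
  exists mu : int, in_Gr mu W.

Definition sato (W : set op) (S : op) : Prop :=
  exists mu : int, in_Gr mu W /\
    is_hatPi S /\ ord_eq S mu /\ regular S mu /\
    W = [set diamond f S | f in in_F].

End Operators.

(* Main.v *)
(** For [k] in N^n let row [k] of an operator [P] be [d^k o P] modulo
    [(x_1, ..., x_n)].  Rows turn composition into multiplication of infinite
    matrices over K_y, so that associativity is the associativity of matrix
    products, and [P |-> mat P] is a bijection.

    Existence: [(d^k <> S) f] lies in [W = F <> S], say it is [h_k <> S];
    then [L_S(f)] is the operator with rows [h_k], and regularity of [S]
    gives [ord h_k <= |k| + ord f].

    Uniqueness: an operator of D_n^sym has rows in K_y[[d]] that need not lie
    in F, so regularity alone does not suffice.  The Hilbert function of [W]
    shows that [g |-> g <> bar S] is injective on K[d]; looking at the lowest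
    terms in [y] one gets injectivity of [P |-> P o S].

    [ord f <= ord L_S(f)] holds since the leading coefficient of [S o f] is
    the product of those of [S] and [f] for a suitable monomial order; the
    remaining claims follow from uniqueness. *)
Require Import Defs.
From HB Require Import structures.
From mathcomp Require Import all_boot all_order all_algebra.
From mathcomp Require Import boolp classical_sets functions cardinality fsbigop.
From mathcomp Require Import zify ring.

Set Implicit Arguments.
Unset Strict Implicit.
Unset Printing Implicit Defensive.

Import Order.TTheory GRing.Theory Num.Theory.
Local Open Scope classical_set_scope.
Local Open Scope ring_scope.

(** The map [mat] is bijective because it is triangular: row [k] involves only the coefficients of
    [x^j] with [j <= k], and that of [x^k] enters with the factor [k!], invertible in characteristic
    0.

    Not every product makes sense on series with infinitely many powers of [d_n] in both directions.
    In [P o S] the rows of [P] have exponents in N^n, bounded in terms of the degree in [y]. In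
    [S o f] the factor [f] is free of [x] and has bounded powers of [d_n], and it acts on rows by a
    Toeplitz matrix. These bounds confine the intermediate indices of every double or triple product
    to finite sets, which is what associativity of infinite matrices requires.

    For uniqueness, the row [sum_i y_1^i d_n^i] shows the obstacle: it has order 0 but unbounded
    powers of [d_n], so it is not in [F]. At a fixed exponent of [y], however, finite order leaves a
    polynomial in [d].

    The same series has no anti-lexicographically largest term. Leading terms are therefore taken at
    a fixed exponent of [x] and by order first. *)

(** * Finitely supported sums *)

Section FiniteSums.
Variable R : idomainType.

(** An infinite support gives the value 0, so additivity and interchange of sums rely on [fin].
    Nonzero scalar factors (over a domain) and injective reindexing carry supports to supports,
    finite or not. *)
Definition fsum (T : choiceType) (F : T -> R) : R := \sum_(t \in [set: T]) F t.
Definition fin (T : choiceType) (F : T -> R) : Prop :=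
  finite_set [set t | F t != 0].

Lemma eq_fsum (T : choiceType) (F G : T -> R) : F =1 G -> fsum F = fsum G.
Proof. by move=> /funext ->. Qed.

Lemma fsumE (T : choiceType) (F : T -> R) (s : seq T) :
  uniq s -> (forall t, F t != 0 -> t \in s) -> fsum F = \sum_(t <- s) F t.
Proof.
move=> us Fs; rewrite /fsum (fsbigE s) //.
  by apply: eq_bigl => t; rewrite in_setT.
by move=> t _ ts; apply/eqP; apply: contraNT ts; apply: Fs.
Qed.

Lemma fin_seq (T : choiceType) (F : T -> R) : fin F ->
  exists2 s : seq T, uniq s & forall t, (F t != 0) = (t \in s).
Proof.
move=> /finite_fsetP[s Fs]; exists (finmap.enum_fset s); first exact: finmap.fset_uniq.
move=> t; have /= E := congr1 (fun D => D t) Fs.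
by apply/idP/idP; rewrite E.
Qed.

Lemma fsum_neq0 (T : choiceType) (F : T -> R) :
  fsum F != 0 -> exists t, F t != 0.
Proof.
apply: contra_neqP => F0; apply: fsbig1 => t _.
by apply/eqP; apply: contra_notT F0 => Ft; exists t.
Qed.

Lemma fsum0 (T : choiceType) (F : T -> R) : (forall t, F t = 0) -> fsum F = 0.
Proof. by move=> F0; apply: fsbig1 => t _. Qed.

Lemma fsum_single (T : choiceType) (t0 : T) (F : T -> R) :
  (forall t, t != t0 -> F t = 0) -> fsum F = F t0.
Proof.
move=> F0; rewrite (@fsumE _ _ [:: t0]) ?big_seq1 // => t.
by rewrite inE; apply: contraNT => /F0 ->.
Qed.

Lemma mulr_fsum_l (T : choiceType) (a : R) (F : T -> R) :
  a * fsum F = fsum (fun t => a * F t).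
Proof. exact: mulr_fsumr. Qed.

Lemma mulr_fsum_r (T : choiceType) (a : R) (F : T -> R) :
  fsum F * a = fsum (fun t => F t * a).
Proof. exact: mulr_fsuml. Qed.

Lemma fin_sub (T : choiceType) (D : set T) (F : T -> R) :
  finite_set D -> (forall t, F t != 0 -> D t) -> fin F.
Proof. by move=> fD FD; apply: sub_finite_set fD. Qed.

Lemma fsumD (T : choiceType) (F G : T -> R) : fin F -> fin G ->
  fsum (fun t => F t + G t) = fsum F + fsum G.
Proof.
move=> /fin_seq[s us Fs] /fin_seq[s' us' Gs].
have u : uniq (undup (s ++ s')) by exact: undup_uniq.
rewrite !(fsumE u) ?big_split // => t; rewrite mem_undup mem_cat -Fs -Gs.
- by move=> ->; rewrite orbT.
- by move=> ->.
- by apply: contraNT; rewrite negb_or !negbK => /andP[/eqP -> /eqP ->]; rewrite addr0.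
Qed.

Lemma fsum_inj (I J : choiceType) (h : I -> J) (F : J -> R) : injective h ->
  (forall j, F j != 0 -> exists i, h i = j) -> fsum F = fsum (F \o h).
Proof.
move=> hI cov; rewrite /fsum [RHS](_ : _ = \sum_(j \in range h) F j).
  apply/esym/fsbig_widen => // j [_ nj] /=; apply/eqP; apply: contra_notT nj => /cov[i <-].
  by exists i.
by rewrite fsbig_image // => x y _ _; apply: hI.
Qed.

Lemma fin_inj (I J : choiceType) (h : I -> J) (F : J -> R) :
  (forall j, F j != 0 -> exists i, h i = j) -> fin (F \o h) -> fin F.
Proof.
move=> cov /(finite_image h); apply: sub_finite_set => j /= Fj.
by have [i hi] := cov j Fj; exists i => //=; rewrite hi.
Qed.

Lemma fsum_pair (I J : choiceType) (F : I -> J -> R) :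
  fin (fun p : I * J => F p.1 p.2) ->
  fsum (fun i => fsum (F i)) = fsum (fun p : I * J => F p.1 p.2).
Proof.
move=> /fin_seq[s us Fs].
pose si := undup [seq p.1 | p <- s]; pose sj := undup [seq p.2 | p <- s].
have hi i j : F i j != 0 -> i \in si.
  by rewrite (Fs (i, j)) mem_undup => /(map_f fst).
have hj i j : F i j != 0 -> j \in sj.
  by rewrite (Fs (i, j)) mem_undup => /(map_f snd).
rewrite (@fsumE _ _ si) ?undup_uniq //; last by move=> i /fsum_neq0[j /hi].
rewrite (eq_bigr (fun i => \sum_(j <- sj) F i j)); last first.
  by move=> i _; rewrite (@fsumE _ _ sj) ?undup_uniq // => j /hj.
transitivity (\sum_(p <- [seq (i, j) | i <- si, j <- sj]) F p.1 p.2).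
  by rewrite big_allpairs.
rewrite -fsumE //.
  by rewrite allpairs_uniq ?undup_uniq // => -[a b] [c d].
move=> [i j] /= Fij; apply/allpairsP; exists (i, j) => /=.
by split=> //; [apply: hi Fij | apply: hj Fij].
Qed.

Lemma fin_swap (I J : choiceType) (F : I -> J -> R) :
  fin (fun p : I * J => F p.1 p.2) -> fin (fun p : J * I => F p.2 p.1).
Proof.
apply: (@fin_inj (I * J)%type (J * I)%type (fun p => (p.2, p.1))).
by move=> [j i] _; exists (i, j).
Qed.

Lemma fsum_exchange (I J : choiceType) (F : I -> J -> R) :
  fin (fun p : I * J => F p.1 p.2) ->
  fsum (fun i => fsum (F i)) = fsum (fun j => fsum (F^~ j)).
Proof.
move=> fF; rewrite fsum_pair // [RHS]fsum_pair /=; last exact: (fin_swap fF).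
rewrite (@fsum_inj (J * I)%type _ (fun p => (p.2, p.1))) //.
  by move=> [a b] [c d] [-> ->].
by move=> [i j] _; exists (j, i).
Qed.

End FiniteSums.

(** * Multi-indices: finiteness, componentwise order, degree *)

Lemma finite_pair (T U : Type) (A : set T) (B : set U) (D : set (T * U)) :
  finite_set A -> finite_set B -> (forall p, D p -> A p.1 /\ B p.2) ->
  finite_set D.
Proof.
by move=> fA fB DAB; apply: sub_finite_set (finite_setX fA fB) => p /DAB.
Qed.

Lemma finite_ffun_nat (I : finType) (D : set {ffun I -> nat}) (N : nat) :
  (forall k, D k -> forall i, (k i <= N)%N) -> finite_set D.
Proof.
move=> DN; pose g (x : {ffun I -> 'I_N.+1}) := [ffun i => nat_of_ord (x i)].
apply: (@sub_finite_set _ _ (range g)); last first.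
  exact/finite_image/finite_finset.
move=> k /DN kN; exists [ffun i => inord (k i)] => //.
by apply/ffunP => i; rewrite !ffunE inordK // ltnS.
Qed.

Lemma finite_ffun_int (I : finType) (D : set {ffun I -> int}) (N : nat) :
  (forall k, D k -> forall i, `|k i| <= N%:Z) -> finite_set D.
Proof.
move=> DN; pose g (x : {ffun I -> nat}) : {ffun I -> int} :=
  [ffun i => (x i)%:Z - N%:Z].
apply: (@sub_finite_set _ _ (g @` [set x : {ffun I -> nat} | forall i, (x i <= N + N)%N])).
  move=> k /DN kN; exists [ffun i => absz (k i + N%:Z)] => /=.
    by move=> i; rewrite ffunE; have := kN i; lia.
  by apply/ffunP => i; rewrite !ffunE; have := kN i; lia.
by apply: finite_image; apply: (@finite_ffun_nat _ _ (N + N)%N).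
Qed.

Section MultiIndex.
Variables (I : finType).
Implicit Types k j a b : {ffun I -> nat}.

Definition zi k : {ffun I -> int} := [ffun i => (k i)%:Z].
Definition subx k j : {ffun I -> nat} := [ffun i => (k i - j i)%N].
Definition lex j k : bool := [forall i, j i <= k i]%N.
Definition deg k : nat := \sum_i k i.

Lemma addxE k j i : (k + j) i = (k i + j i)%N.
Proof. by rewrite ffunE. Qed.

Lemma lexP j k : reflect (forall i, j i <= k i)%N (lex j k).
Proof. exact: forallP. Qed.

Lemma addxK k j : subx (k + j) j = k.
Proof. by apply/ffunP => i; rewrite ffunE addxE addnK. Qed.

Lemma subxK k j : lex j k -> subx k j + j = k.
Proof. by move=> /lexP jk; apply/ffunP => i; rewrite addxE ffunE subnK. Qed.

Lemma addxI j : injective (fun k => k + j).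
Proof. exact: (can_inj (g := subx^~ j) (fun k => addxK k j)). Qed.

Lemma lex_addr k j : lex j (k + j).
Proof. by apply/lexP => i; rewrite addxE leq_addl. Qed.

Lemma ziD k j : zi (k + j) = zi k + zi j.
Proof. by apply/ffunP => i; rewrite !ffunE PoszD. Qed.

Lemma zi_subx k j : lex j k -> zi (subx k j) = zi k - zi j.
Proof. by move=> /subxK {2}<-; rewrite ziD addrK. Qed.

Lemma zi_inj : injective zi.
Proof. by move=> k j /ffunP kj; apply/ffunP => i; have := kj i; rewrite !ffunE => -[]. Qed.

Lemma zi0 : zi 0 = 0.
Proof. by apply/ffunP => i; rewrite !ffunE. Qed.

Lemma zi_surj (l : {ffun I -> int}) : (forall i, 0 <= l i) -> exists k, zi k = l.
Proof.
move=> l0; exists [ffun i => absz (l i)]; apply/ffunP => i; rewrite !ffunE.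
by rewrite gez0_abs.
Qed.

Lemma degD k j : deg (k + j) = (deg k + deg j)%N.
Proof. by rewrite /deg -big_split; apply: eq_bigr => i _; rewrite addxE. Qed.

Lemma leq_deg k i : (k i <= deg k)%N.
Proof. by rewrite /deg (bigD1 i) //= leq_addr. Qed.

Lemma lex_deg j k : lex j k -> (deg j <= deg k)%N.
Proof. by move=> /lexP jk; apply: leq_sum. Qed.

Lemma deg_eq0 k : (deg k == 0)%N = (k == 0).
Proof.
apply/eqP/eqP => [k0|->]; last by rewrite /deg big1 // => i _; rewrite ffunE.
by apply/ffunP => i; have := leq_deg k i; rewrite k0 leqn0 ffunE => /eqP.
Qed.

Lemma deg0 : deg (0 : {ffun I -> nat}) = 0%N.
Proof. by apply/eqP; rewrite deg_eq0. Qed.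

Lemma lex_deg_lt j k : lex j k -> j != k -> (deg j < deg k)%N.
Proof.
move=> jk; apply: contraNT; rewrite -leqNgt => kj; have E := subxK jk.
have /eqP : deg (subx k j) = 0%N by have := degD (subx k j) j; rewrite E; lia.
by rewrite deg_eq0 => /eqP H; rewrite -E H add0r.
Qed.

Lemma finite_deg (D : set {ffun I -> nat}) (N : nat) :
  (forall k, D k -> (deg k <= N)%N) -> finite_set D.
Proof.
move=> DN; apply: (@finite_ffun_nat _ _ N) => k /DN kN i.
exact: leq_trans (leq_deg k i) kN.
Qed.

Lemma finite_lex (D : set {ffun I -> nat}) k :
  (forall j, D j -> lex j k) -> finite_set D.
Proof. by move=> Dk; apply: (@finite_deg _ (deg k)) => j /Dk /lex_deg. Qed.

End MultiIndex.

Lemma abskD (n : nat) (k l : didx n) : absk (k + l) = absk k + absk l.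
Proof. by rewrite /absk -big_split; apply: eq_bigr => i _; rewrite ffunE. Qed.

Lemma abskN (n : nat) (k : didx n) : absk (- k) = - absk k.
Proof. by rewrite /absk -sumrN; apply: eq_bigr => i _; rewrite ffunE. Qed.

Lemma absk_zi (n : nat) (k : pdidx n) : absk (zi k) = (deg k)%:Z.
Proof.
rewrite /absk /deg -[RHS]natz natr_sum; apply: eq_bigr => i _.
by rewrite ffunE natz.
Qed.

(** * Falling factorials and binomial coefficients *)

Lemma ffactnD (k a s : nat) : (k ^_ (a + s) = k ^_ a * (k - a) ^_ s)%N.
Proof.
elim: a k => [|a IH] [|k]; rewrite ?ffactn0 ?mul1n ?subn0 //.
by rewrite addSn !ffactSS IH mulnA.
Qed.

(* Vandermonde in the form x^_(b-i) C(p,i) b^_i = b! C(x,b-i) C(p,i). *)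
Lemma ffact_Vandermonde (x p b N : nat) : (b < N)%N ->
  (\sum_(i < N) x ^_ (b - i) * 'C(p, i) * b ^_ i = (x + p) ^_ b)%N.
Proof.
move=> bN; rewrite -(big_mkord xpredT (fun i => x ^_ (b - i) * 'C(p, i) * b ^_ i)%N).
rewrite (big_cat_nat (n := b.+1)) //= [X in (_ + X)%N]big1_seq ?addn0; last first.
  by move=> i /=; rewrite mem_index_iota => /andP[bi _]; rewrite (ffact_small bi) muln0.
rewrite addnC -bin_ffact -binomial.Vandermonde big_distrl big_mkord.
apply: eq_bigr => -[i /= ib] _.
rewrite -(bin_ffact x) -(ffact_fact (n := b) (m := i)) //; nia.
Qed.

Section Char0.
Variables (K : fieldType) (charK0 : [pchar K] =i pred0).

Lemma natrK_eq0 (k : nat) : (k%:R == 0 :> K) = (k == 0%N).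
Proof. by have /pcharf0P := charK0. Qed.

Lemma binz_nat (p j : nat) : binz K p%:Z j = ('C(p, j))%:R.
Proof.
have j0 : (j`!)%:R != 0 :> K by rewrite natrK_eq0 -lt0n fact_gt0.
rewrite /binz; apply: (mulIf j0); rewrite mulfVK // -natrM bin_ffact.
have [pj|jp] := ltnP p j.
  by rewrite (ffact_small pj) (bigD1 (Ordinal pj)) //= subrr mul0r.
rewrite ffact_prod natr_prod; apply: eq_bigr => -[i /= ij] _.
by rewrite subzn ?pmulrn //; lia.
Qed.

End Char0.

Section FallingFactorial.
Variables (K : fieldType) (n : nat).
Local Notation X := {ffun 'I_n -> nat}.
Implicit Types k j a b p : X.

Lemma fsum_finType (T : finType) (F : T -> K) : fsum F = \sum_t F t.
Proof.
rewrite (@fsumE _ _ _ (enum T)) ?enum_uniq ?big_enum // => t _.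
by rewrite mem_enum.
Qed.

Lemma fsum_prod (g : 'I_n -> nat -> K) (N : nat) :
  (forall i t, (N <= t)%N -> g i t = 0) ->
  fsum (fun j : X => \prod_i g i (j i)) = \prod_i \sum_(t < N) g i t.
Proof.
move=> gN; rewrite bigA_distr_bigA /=.
pose h (f : {ffun 'I_n -> 'I_N}) : X := [ffun i => nat_of_ord (f i)].
rewrite (@fsum_inj _ _ _ h).
- by rewrite fsum_finType; apply: eq_bigr => f _; apply: eq_bigr => i _; rewrite ffunE.
- by move=> f g' /ffunP E; apply/ffunP => i; apply: ord_inj; have := E i; rewrite !ffunE.
move=> j /prodf_neq0 jN.
have jlt i : (j i < N)%N by rewrite ltnNge; apply/negP => /(gN i) E; have := jN i isT; rewrite E eqxx.
by exists [ffun i => Ordinal (jlt i)]; apply/ffunP => i; rewrite !ffunE.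
Qed.

(** The coefficient in [d^j(x^k) = ff k j * x^(k-j)], and also the coefficient of [d^(k-j)] in
    [d^k o x^j] modulo [(x_1, ..., x_n)]. *)
Definition ff k j : K := \prod_i ((k i) ^_ (j i))%:R.
Definition binx k j : K := \prod_i ('C(k i, j i))%:R.

Lemma ff_neq0 k j : ff k j != 0 -> lex j k.
Proof.
move=> /prodf_neq0 H; apply/lexP => i; have := H i isT; rewrite leqNgt.
by apply: contraNN => /ffact_small ->.
Qed.

Lemma binx_neq0 k j : binx k j != 0 -> lex j k.
Proof.
move=> /prodf_neq0 H; apply/lexP => i; have := H i isT; rewrite leqNgt.
by apply: contraNN => /bin_small ->.
Qed.

Lemma ff0 k : ff k 0 = 1.
Proof. by rewrite /ff big1 // => i _; rewrite ffunE ffactn0. Qed.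

Lemma ffD k a b : ff k (a + b) = ff k a * ff (subx k a) b.
Proof.
rewrite /ff -big_split; apply: eq_bigr => i _.
by rewrite addxE ffunE ffactnD natrM.
Qed.

(** The coefficient form of [d^k o d^p = d^(k+p)] applied to [x^b] modulo [(x)]: the Leibniz rule
    for [d^p] differentiates [x^b] to [x^(b-i)], which [d^k] then absorbs. The truncated difference
    [subx b i] is harmless, as [ff b i] vanishes unless [i <= b]. *)
Lemma ff_Vandermonde k p b :
  fsum (fun i => ff k (subx b i) * binx p i * ff b i) = ff (k + p) b.
Proof.
under eq_fsum do rewrite /ff /binx -!big_split /=.
under eq_fsum => j do under eq_bigr => i _ do rewrite ffunE.
rewrite (@fsum_prod (fun i t => (k i ^_ (b i - t))%:R * ('C(p i, t))%:R * (b i ^_ t)%:R)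
  (deg b).+1); last first.
  move=> i j bj; rewrite [X in _ * X%:R]ffact_small ?mulr0 //.
  by apply: leq_ltn_trans bj; apply: leq_deg.
apply: eq_bigr => i _; rewrite addxE -(@ffact_Vandermonde _ _ _ (deg b).+1).
  by rewrite natr_sum; apply: eq_bigr => j _; rewrite !natrM.
by rewrite ltnS leq_deg.
Qed.

Lemma ffkk_neq0 (charK0 : [pchar K] =i pred0) k : ff k k != 0.
Proof.
by apply/prodf_neq0 => i _; rewrite ffactnn natrK_eq0 // -lt0n fact_gt0.
Qed.

Lemma binzm_nat (charK0 : [pchar K] =i pred0) k j : binzm K (zi k) j = binx k j.
Proof. by apply: eq_bigr => i _; rewrite ffunE binz_nat. Qed.

Lemma binzm0 (k : {ffun 'I_n -> int}) : binzm K k 0 = 1.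
Proof. by rewrite /binzm big1 // => i _; rewrite ffunE /binz big_ord0 fact0 divr1. Qed.

End FallingFactorial.

(* Same as [lexP], in the syntactic form that [lia] needs. *)
Lemma lex_ord (n : nat) (j k : {ffun 'I_n -> nat}) :
  lex j k -> forall i : 'I_n, (j i <= k i)%N.
Proof. by move/lexP. Qed.

Lemma leq_deg_ord (n : nat) (k : {ffun 'I_n -> nat}) (i : 'I_n) : (k i <= deg k)%N.
Proof. exact: leq_deg. Qed.

Lemma addx_ord (n : nat) (k j : {ffun 'I_n -> nat}) (i : 'I_n) :
  (k + j) i = (k i + j i)%N.
Proof. exact: addxE. Qed.

(** * Cauchy products and infinite matrices over power series in [y] *)

Section Convolution.
Variable R : idomainType.

Lemma fin_section (I J : choiceType) (F : I -> J -> R) (i : I) :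
  fin (fun p : I * J => F p.1 p.2) -> fin (F i).
Proof.
move=> /(finite_image snd); apply: sub_finite_set => j /= Fij.
by exists (i, j).
Qed.

Lemma fsum_triple (I J L : choiceType) (F : I -> J -> L -> R) :
  fin (fun p : I * (J * L) => F p.1 p.2.1 p.2.2) ->
  fsum (fun i => fsum (fun j => fsum (F i j))) =
  fsum (fun p : I * (J * L) => F p.1 p.2.1 p.2.2).
Proof.
move=> fF; rewrite -[RHS](fsum_pair (F := fun i q => F i q.1 q.2)) //.
apply: eq_fsum => i; apply: fsum_pair.
exact: (fin_section (F := fun i q => F i q.1 q.2) i fF).
Qed.

(** The finiteness hypothesis includes the factor [c]: where [c i j] vanishes the inner support may
    be infinite, and the term is 0 on both sides. *)
Lemma fsum_nested (I J L N : choiceType) (c : I -> J -> R) (D : I -> J -> L -> N -> R) :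
  fin (fun p : I * (J * (L * N)) => c p.1 p.2.1 * D p.1 p.2.1 p.2.2.1 p.2.2.2) ->
  fsum (fun i => fsum (fun j => c i j * fsum (fun l => fsum (D i j l)))) =
  fsum (fun p : I * (J * (L * N)) => c p.1 p.2.1 * D p.1 p.2.1 p.2.2.1 p.2.2.2).
Proof.
move=> fF; rewrite -(fsum_triple (F := fun i j q => c i j * D i j q.1 q.2)) //.
apply: eq_fsum => i; apply: eq_fsum => j; rewrite -mulr_fsum_l.
have [->|c0] := eqVneq (c i j) 0; first by rewrite !mul0r.
congr (_ * _); apply: fsum_pair.
have := fin_section i (F := fun i q => c i q.1 * D i q.1 q.2.1 q.2.2) fF.
move=> /(fin_section j (F := fun j q => c i j * D i j q.1 q.2)).
by apply: sub_finite_set => q /= q0; rewrite mulf_neq0.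
Qed.

Lemma natb_neq0 (b : bool) : (b%:R != 0 :> R) = b.
Proof. by case: b; rewrite ?eqxx ?oner_eq0. Qed.

(** The Cauchy product, over any commutative monoid of exponents because it serves both for
    exponents of [y] and for pairs of exponents of [y] and [x]. *)
Definition conv (T : nmodType) (a b : T -> R) (e : T) : R :=
  fsum (fun p : T * T => (p.1 + p.2 == e)%:R * (a p.1 * b p.2)).

Lemma conv_neq0 (T : nmodType) (a b : T -> R) e : conv a b e != 0 ->
  exists p : T * T, [/\ p.1 + p.2 = e, a p.1 != 0 & b p.2 != 0].
Proof.
move=> /fsum_neq0[p]; rewrite !mulf_eq0 !negb_or => /and3P[pe ap bp].
by exists p; split=> //; apply/eqP; move: pe; rewrite natb_neq0.
Qed.

Lemma conv0l (T : nmodType) (a b : T -> R) e : (forall t, a t = 0) -> conv a b e = 0.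
Proof. by move=> a0; apply: fsum0 => p; rewrite a0 mul0r mulr0. Qed.

Lemma eq_conv (T : nmodType) (a b a' b' : T -> R) e :
  a =1 a' -> b =1 b' -> conv a b e = conv a' b' e.
Proof. by move=> /funext -> /funext ->. Qed.

Lemma finite_splits (I : finType) (e : {ffun I -> nat}) :
  finite_set [set p : {ffun I -> nat} * {ffun I -> nat} | p.1 + p.2 = e].
Proof.
have h : finite_set [set u : {ffun I -> nat} | lex u e].
  by apply: (@finite_lex _ _ e).
apply: (finite_pair h h) => -[u v] /= <-; split; last exact: lex_addr.
by rewrite addrC lex_addr.
Qed.

Variables (M : finType).
Local Notation Y := {ffun M -> nat}.

Lemma fin_conv (a b : Y -> R) e :
  fin (fun p : Y * Y => (p.1 + p.2 == e)%:R * (a p.1 * b p.2)).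
Proof.
apply: (fin_sub (finite_splits e)) => p; rewrite mulf_eq0 negb_or natb_neq0.
by case/andP=> /eqP.
Qed.

Lemma convDl (a b c : Y -> R) e :
  conv (fun t => a t + b t) c e = conv a c e + conv b c e.
Proof.
rewrite /conv -fsumD; try exact: fin_conv.
by apply: eq_fsum => p; rewrite mulrDl mulrDr.
Qed.

Definition mmul (I J L : choiceType) (A : I -> J -> Y -> R) (B : J -> L -> Y -> R) :
    I -> L -> Y -> R :=
  fun i l e => fsum (fun j => conv (A i j) (B j l) e).

Lemma mmul_neq0 (I J L : choiceType) (A : I -> J -> Y -> R) (B : J -> L -> Y -> R) i l e :
  mmul A B i l e != 0 ->
  exists j u v, [/\ u + v = e, A i j u != 0 & B j l v != 0].
Proof. by move=> /fsum_neq0[j] /conv_neq0[[u v] []]; exists j, u, v. Qed.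

(** Both sides equal one sum [G] over intermediate indices [j], [l] and splittings [u + v + w = e].
    The exponent of the inner product, [v + w] or [u + v], is determined by the splitting, and the
    two maps [h] only insert it. Finiteness is asked for one entry at a time. *)
Lemma mmulA (I J L N : choiceType) (A : I -> J -> Y -> R) (B : J -> L -> Y -> R)
    (C : L -> N -> Y -> R) i x e :
  finite_set [set p : J * L | exists u v w,
     [/\ u + v + w = e, A i p.1 u != 0, B p.1 p.2 v != 0 & C p.2 x w != 0]] ->
  mmul A (mmul B C) i x e = mmul (mmul A B) C i x e.
Proof.
move=> fin0.
pose T := ((J * L) * (Y * (Y * Y)))%type.
pose G (q : T) : R := (q.2.1 + q.2.2.1 + q.2.2.2 == e)%:R *
  (A i q.1.1 q.2.1 * B q.1.1 q.1.2 q.2.2.1 * C q.1.2 x q.2.2.2).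
have finG : fin G.
  have h : finite_set [set u : Y | lex u e] by apply: (@finite_lex _ _ e).
  have h3 : finite_set ([set u : Y | lex u e] `*` ([set u : Y | lex u e] `*` [set u : Y | lex u e])).
    by apply: finite_setX => //; apply: finite_setX.
  apply: (finite_pair fin0 h3) => -[[j l] [u [v w]]] /=.
  rewrite /G /= !mulf_eq0 !negb_or natb_neq0 -!andbA => /and4P[/eqP <- a0 b0 c0].
  split; first by exists u, v, w.
  split=> /=; first by rewrite -addrA addrC lex_addr.
  by split=> /=; rewrite ?lex_addr // addrAC lex_addr.
transitivity (fsum G).
- pose c (j : J) (p : Y * Y) := (p.1 + p.2 == e)%:R * A i j p.1.
  pose D (j : J) (p : Y * Y) (l : L) (q : Y * Y) :=
    (q.1 + q.2 == p.2)%:R * (B j l q.1 * C l x q.2).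
  pose h (q : T) : J * ((Y * Y) * (L * (Y * Y))) :=
    (q.1.1, ((q.2.1, q.2.2.1 + q.2.2.2), (q.1.2, q.2.2))).
  pose FF (p : J * ((Y * Y) * (L * (Y * Y)))) :=
    c p.1 p.2.1 * D p.1 p.2.1 p.2.2.1 p.2.2.2.
  have cov q : FF q != 0 -> exists t, h t = q.
    case: q => j [[u z] [l [v w]]]; rewrite /FF /c /D /= !mulf_eq0 !negb_or !natb_neq0.
    by case/andP=> _ /andP[/eqP <- _]; exists ((j, l), (u, (v, w))).
  have E : FF \o h =1 G.
    by move=> [[j l] [u [v w]]]; rewrite /FF /c /D /G /= eqxx mul1r addrA !mulrA.
  have fF : fin FF by apply: (fin_inj cov); rewrite (funext E).
  rewrite -(eq_fsum E) -fsum_inj //; last first.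
    by move=> [[? ?] [? [? ?]]] [[? ?] [? [? ?]]] [-> -> _ -> -> ->].
  rewrite -(fsum_nested (c := c) (D := D)) //.
  by apply: eq_fsum => j; apply: eq_fsum => p; rewrite /c /D mulrA.
- pose c (l : L) (p : Y * Y) := (p.1 + p.2 == e)%:R * C l x p.2.
  pose D (l : L) (p : Y * Y) (j : J) (q : Y * Y) :=
    (q.1 + q.2 == p.1)%:R * (A i j q.1 * B j l q.2).
  pose h (q : T) : L * ((Y * Y) * (J * (Y * Y))) :=
    (q.1.2, ((q.2.1 + q.2.2.1, q.2.2.2), (q.1.1, (q.2.1, q.2.2.1)))).
  pose FF (p : L * ((Y * Y) * (J * (Y * Y)))) :=
    c p.1 p.2.1 * D p.1 p.2.1 p.2.2.1 p.2.2.2.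
  have cov q : FF q != 0 -> exists t, h t = q.
    case: q => l [[z w] [j [u v]]]; rewrite /FF /c /D /= !mulf_eq0 !negb_or !natb_neq0.
    by case/andP=> _ /andP[/eqP <- _]; exists ((j, l), (u, (v, w))).
  have E : FF \o h =1 G.
    by move=> [[j l] [u [v w]]]; rewrite /FF /c /D /G /= eqxx mul1r -mulrA [C _ _ _ * _]mulrC.
  have fF : fin FF by apply: (fin_inj cov); rewrite (funext E).
  rewrite -(eq_fsum E) -fsum_inj //; last first.
    by move=> [[? ?] [? [? ?]]] [[? ?] [? [? ?]]] [-> _ -> -> -> ->].
  rewrite -(fsum_nested (c := c) (D := D)) //.
  apply: eq_fsum => l; apply: eq_fsum => p; rewrite /c /D.
  by rewrite mulrAC -mulrA mulrC -mulrA.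
Qed.

End Convolution.

(** * The matrix of an operator *)

Section Mat.
Variables (K : fieldType) (m n : nat).
Hypothesis charK0 : [pchar K] =i pred0.
Local Notation X := {ffun 'I_n -> nat}.
Local Notation Z := {ffun 'I_n -> int}.
Local Notation Y := {ffun 'I_m -> nat}.
Local Notation op := (op K m n).
Implicit Types (P Q S f : op) (k j a b p t : X) (l r : Z) (e u v : Y).

Lemma shiftE l k j (i : 'I_n) : (l - zi k + zi j) i = l i - (k i)%:Z + (j i)%:Z.
Proof. by rewrite !ffunE. Qed.

(* The coefficient of [y^e d^l] in [d^k o P] modulo [(x_1, ..., x_n)]. *)
Definition mat P k l e : K :=
  fsum (fun j : X => ff K k j * P (l - zi k + zi j) (e, j)).

(** Rows of an operator of [D_n^sym] are supported on N^n; as a left factor its columns are then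
    indexed like the rows of the right factor. *)
Definition matx P k t e : K := mat P k (zi t) e.

Lemma fin_mat k (F : X -> K) : fin (fun j => ff K k j * F j).
Proof.
have h : finite_set [set j : X | lex j k] by apply: (@finite_lex _ _ k).
by apply: (fin_sub h) => j; rewrite mulf_eq0 negb_or => /andP[/ff_neq0].
Qed.

Lemma mat_neq0 P k l e : mat P k l e != 0 ->
  exists2 j : X, lex j k & P (l - zi k + zi j) (e, j) != 0.
Proof.
move=> /fsum_neq0[j]; rewrite mulf_eq0 negb_or => /andP[/ff_neq0 jk Pj].
by exists j.
Qed.

Lemma mat0 P l e : mat P 0 l e = P l (e, 0).
Proof.
rewrite /mat (@fsum_single _ _ 0) ?ff0 ?mul1r ?zi0 ?subr0 ?addr0 // => j j0.
apply/eqP; rewrite mulf_eq0; apply/orP; left; apply: contraNT j0 => /ff_neq0.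
by move/lex_deg; rewrite deg0 leqn0 deg_eq0.
Qed.

Lemma mat_opadd P Q k l e : mat (opadd P Q) k l e = mat P k l e + mat Q k l e.
Proof.
rewrite /mat -fsumD; try exact: fin_mat.
by apply: eq_fsum => j; rewrite mulrDr.
Qed.

Lemma mat_opscale c P k l e : mat (opscale c P) k l e = c * mat P k l e.
Proof. by rewrite /mat mulr_fsum_l; apply: eq_fsum => j; rewrite mulrCA. Qed.

(** Splits off the diagonal term of the triangular system; the remaining terms have [j <= k] and
    [j != k], hence smaller degree. *)
Lemma mat_recl P k l e : mat P k l e = ff K k k * P l (e, k) +
  fsum (fun j => ff K k j * ((j != k)%:R * P (l - zi k + zi j) (e, j))).
Proof.
have -> : ff K k k * P l (e, k) =
    fsum (fun j => ff K k j * ((j == k)%:R * P (l - zi k + zi j) (e, j))).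
  rewrite (@fsum_single _ _ k); first by rewrite eqxx mul1r subrK.
  by move=> j /negPf ->; rewrite mul0r mulr0.
rewrite -fsumD; try exact: fin_mat.
apply: eq_fsum => j; rewrite -mulrDr -mulrDl; congr (_ * _).
by case: (j == k); rewrite ?addr0 ?add0r mul1r.
Qed.

(** Carries properties of the support of [mat P] back to that of [P]. If a coefficient is nonzero
    but the matrix entry is 0, the diagonal term is cancelled by a nonzero term of smaller degree in
    [x], to which the induction applies. *)
Lemma mat_ind (c : Z -> Y -> X -> Prop) P :
  (forall k l e, mat P k l e != 0 -> c l e k) ->
  (forall l e j k, lex j k -> c (l - zi k + zi j) e j -> c l e k) ->
  forall l e k, P l (e, k) != 0 -> c l e k.
Proof.
move=> Hm Hc l e k; have [N] := ubnP (deg k).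
elim: N => // N IH in l e k *; rewrite ltnS => kN Pk.
have [m0|/Hm //] := eqVneq (mat P k l e) 0.
have : fsum (fun j => ff K k j * ((j != k)%:R * P (l - zi k + zi j) (e, j))) != 0.
  apply/eqP => F0; move: m0; rewrite mat_recl F0 addr0 => /eqP.
  by rewrite mulf_eq0 (negPf Pk) (negPf (ffkk_neq0 charK0 k)).
move=> /fsum_neq0[j]; rewrite !mulf_eq0 !negb_or natb_neq0.
case/and3P => /ff_neq0 jk njk Pj; apply: (Hc _ _ j) => //; apply: IH => //.
exact: leq_trans (lex_deg_lt jk njk) kN.
Qed.

Lemma mat_inj P Q : (forall k l e, mat P k l e = mat Q k l e) -> P = Q.
Proof.
move=> PQ; pose D := opadd P (opscale (-1) Q).
have HD : forall l e k, D l (e, k) != 0 -> False.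
  apply: mat_ind => // k l e.
  by rewrite mat_opadd mat_opscale PQ mulN1r subrr eqxx.
apply/funext => l; apply/funext => -[e k]; apply/eqP; rewrite -subr_eq0.
apply: contraT => H; exfalso; apply: (HD l e k).
by rewrite /D /opadd /opscale mulN1r.
Qed.

Section Inverse.
Variable H : X -> Z -> Y -> K.

(** Substitution in the triangular system of [mat_recl]. The argument [N] is fuel, sufficient once
    it exceeds the degree of the [x]-exponent, so the value 0 at [N = 0] is never reached from
    there. *)
Fixpoint mat_preim (N : nat) : op :=
  if N is N'.+1 then fun l (z : mon m n) =>
    (ff K z.2 z.2)^-1 * (H z.2 l z.1 -
      fsum (fun j => ff K z.2 j * ((j != z.2)%:R * mat_preim N' (l - zi z.2 + zi j) (z.1, j))))
  else fun _ _ => 0.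

Lemma mat_preim_stable N N' l e k : (deg k < N)%N -> (deg k < N')%N ->
  mat_preim N l (e, k) = mat_preim N' l (e, k).
Proof.
elim: N N' l k => // N IH [|N'] l k //; rewrite !ltnS => kN kN' /=.
congr (_ * (_ - _)); apply: eq_fsum => j.
have [->|] := eqVneq (ff K k j) 0; first by rewrite !mul0r.
move=> /ff_neq0 jk; have [->|jk'] := eqVneq j k; first by rewrite !mul0r.
have := lex_deg_lt jk jk' => jlt.
by rewrite (IH N') //; apply: leq_trans jlt _.
Qed.

Lemma mat_surj : exists P, forall k l e, mat P k l e = H k l e.
Proof.
exists (fun l z => mat_preim (deg z.2).+1 l z) => k l e.
rewrite mat_recl /= mulrA divff ?ffkk_neq0 // mul1r -[RHS]addr0 -addrA.
congr (_ + _); apply/eqP; rewrite addrC subr_eq0; apply/eqP/eq_fsum => j.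
have [->|] := eqVneq (ff K k j) 0; first by rewrite !mul0r.
move=> /ff_neq0 jk; have [->|jk'] := eqVneq j k; first by rewrite !mul0r.
congr (_ * (_ * _)); rewrite -[LHS]/(mat_preim (deg j).+1 (l - zi k + zi j) (e, j)).
by apply: mat_preim_stable => //; apply: lex_deg_lt.
Qed.

End Inverse.

(** The shift by [- zi k + zi j] changes [absk] by [deg j - deg k], while the [x]-exponent [j] costs
    [deg j]: every term of an entry has the same order [absk l - deg e - deg k]. *)
Lemma ord_le_mat P B : ord_le P B <->
  (forall k l e, mat P k l e != 0 -> absk l - (deg e)%:Z - (deg k)%:Z <= B).
Proof.
split=> H.
  move=> k l e /mat_neq0[j jk /H]; rewrite !abskD abskN !absk_zi /degm /=.
  by rewrite -/(deg e) -/(deg j); lia.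
have h : forall l e k, P l (e, k) != 0 -> absk l - (deg e)%:Z - (deg k)%:Z <= B.
  by apply: mat_ind => // l e j k _; rewrite !abskD abskN !absk_zi; lia.
move=> l [e k] /h; rewrite /degm /= -/(deg e) -/(deg k); lia.
Qed.

(** For [j <= k] the index [l - zi k + zi j] lies below [l], so its nonnegativity implies that of
    [l]; both directions rest on this. The predicate [c] selects all coordinates for [D_n^sym] and
    all but the last for [hat Pi_n]. *)
Lemma nonneg_mat (c : pred 'I_n) P :
  (forall l, (exists i, c i /\ l i < 0) -> P l = 0) <->
  (forall k l e, mat P k l e != 0 -> forall i, c i -> 0 <= l i).
Proof.
split=> H.
  move=> k l e /mat_neq0[j /lex_ord jk Pj] i ci; rewrite leNgt; apply/negP => li.
  move: Pj; rewrite H ?eqxx //; exists i; split=> //.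
  by rewrite shiftE; have := jk i; lia.
have h : forall l e k, P l (e, k) != 0 -> forall i, c i -> 0 <= l i.
  apply: (@mat_ind (fun l e k => forall i, c i -> 0 <= l i)) => // l e j k /lex_ord jk h i /h.
  by rewrite shiftE; have := jk i; lia.
move=> l [i [ci li]]; apply/funext => -[e k]; apply/eqP; apply: contraT => /h /(_ i ci).
by rewrite leNgt li.
Qed.

End Mat.

(** * Composition as a matrix product *)

Section Product.
Variables (K : fieldType) (m n : nat).
Hypothesis charK0 : [pchar K] =i pred0.
Local Notation X := {ffun 'I_n -> nat}.
Local Notation Z := {ffun 'I_n -> int}.
Local Notation Y := {ffun 'I_m -> nat}.
Local Notation op := (op K m n).
Local Notation ps := (ps K m n).
Local Notation mon := (mon m n).
Implicit Types (P Q S f : op) (k j a b p t : X) (l r : Z) (e u v : Y).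

Lemma degmE (z : Y * X) : degm z = (deg z.1 + deg z.2)%N.
Proof. by []. Qed.

Lemma degmD (z w : Y * X) : degm (z + w) = (degm z + degm w)%N.
Proof. by rewrite !degmE !degD addnACA. Qed.

Lemma finite_degm (D : set (Y * X)) N : (forall z, D z -> (degm z <= N)%N) -> finite_set D.
Proof.
move=> DN; have h (I : finType) : finite_set [set u : {ffun I -> nat} | (deg u <= N)%N].
  by apply: (@finite_deg _ _ N).
apply: (finite_pair (h _) (h _)) => z /DN zN /=.
by split; apply: leq_trans zN; rewrite /degm ?leq_addr ?leq_addl.
Qed.

Lemma finite_msplits (z : Y * X) :
  finite_set [set p : (Y * X) * (Y * X) | p.1 + p.2 = z].
Proof.
have h : finite_set [set w : Y * X | (degm w <= degm z)%N].
  by apply: (@finite_degm _ (degm z)).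
by apply: (finite_pair h h) => -[u v] /= <-; rewrite !degmD leq_addr leq_addl.
Qed.

Lemma psmulE (a b : ps) (z : Y * X) : psmul a b z = conv a b z.
Proof.
have sub2 (u : Y * X) : lemon u z = (u + submon z u == z).
  apply/andP/eqP => [[/forallP h1 /forallP h2]|<-].
    case: u z h1 h2 => [u1 u2] [z1 z2] /= h1 h2; congr (_, _);
    by apply/ffunP => i; rewrite addxE ffunE /= subnKC.
  by split; apply/forallP => i; rewrite addxE leq_addr.
rewrite /conv (@fsum_inj _ _ _ (fun u : Y * X => (u, submon z u))).
- rewrite /psmul fsbig_mkcond; apply: eq_fsum => u; rewrite /patch /= -sub2.
  have -> : (u \in [set u | lemon u z]) = lemon u z by apply/idP/idP; rewrite inE.
  by case: lemon; rewrite ?mul1r ?mul0r.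
- by move=> u u' [].
- move=> [u v]; rewrite !mulf_eq0 !negb_or natb_neq0 => /andP[/eqP <- _].
  exists u; congr (_, _); case: u v => [u1 u2] [v1 v2]; congr (_, _);
  by apply/ffunP => i; rewrite ffunE /= addxE addKn.
Qed.

Lemma dpowE (i : X) (c : ps) (z : Y * X) :
  dpow i c z = ff K (z.2 + i) i * c (z.1, z.2 + i).
Proof.
rewrite /dpow; have -> : [ffun x => (z.2 x + i x)%N] = z.2 + i.
  by apply/ffunP => x; rewrite !ffunE.
by congr (_ * _); apply: eq_bigr => x _; rewrite addxE.
Qed.

(* [d^p o Q] *)
Definition dop p Q : op := fun r z =>
  fsum (fun i : X => binx K p i * (ff K (z.2 + i) i * Q (r - zi p + zi i) (z.1, z.2 + i))).

(** This is [d^k o (d^p o Q) = d^(k+p) o Q] modulo [(x)]. Collecting the terms with [b = s + i]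
    leaves the sum over [i] evaluated by [ff_Vandermonde]. *)
Lemma mat_dop p Q k l e : mat (dop p Q) k l e = mat Q (k + p) l e.
Proof.
pose F (s i : X) := ff K k s * (binx K p i *
  (ff K (s + i) i * Q (l - zi k + zi s - zi p + zi i) (e, s + i))).
pose G (b i : X) := Q (l - zi (k + p) + zi b) (e, b) *
  (ff K k (subx b i) * binx K p i * ff K b i).
pose h (q : X * X) := (q.1 + q.2, q.2).
have E : (fun q => G q.1 q.2) \o h =1 (fun q => F q.1 q.2).
  move=> [s i]; rewrite /G /F /= addxK !ziD.
  have -> : l - (zi k + zi p) + (zi s + zi i) = l - zi k + zi s - zi p + zi i.
    by rewrite opprD !addrA; congr (_ + _); rewrite addrAC.
  by ring.
have fF : fin (fun q : X * X => F q.1 q.2).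
  have h1 : finite_set [set s : X | lex s k] by apply: (@finite_lex _ _ k).
  have h2 : finite_set [set s : X | lex s p] by apply: (@finite_lex _ _ p).
  apply: (fin_sub (finite_setX h1 h2)) => -[s i].
  by rewrite !mulf_eq0 !negb_or => /and3P[/ff_neq0 ? /binx_neq0 ?].
have cov q : G q.1 q.2 != 0 -> exists q', h q' = q.
  case: q => b i; rewrite !mulf_eq0 !negb_or => /andP[_ /andP[_ /ff_neq0 ib]].
  by exists (subx b i, i); rewrite /h /= subxK.
have fG : fin (fun q : X * X => G q.1 q.2).
  by apply: (fin_inj cov); rewrite (funext E).
transitivity (fsum (fun s => fsum (F s))).
  by apply: eq_fsum => s; rewrite /dop mulr_fsum_l.
rewrite fsum_pair // -(eq_fsum E) -fsum_inj //; last first.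
  by move=> [s i] [s' i'] [] + ii; rewrite ii => /addxI ->.
rewrite -(fsum_pair (F := G)) //; apply: eq_fsum => b.
by rewrite -mulr_fsum_l ff_Vandermonde mulrC.
Qed.

(** The composition regrouped as the sum of [P_p (d^p o Q)]. Only finitely many [p] matter: a
    coefficient of [P_p] at a divisor of [z] is nonzero only if [deg p] is at most the order bound
    plus [degm z]. *)
Lemma opmul_Dsym P Q r (z : Y * X) : is_Dsym P ->
  opmul P Q r z = fsum (fun p : X => conv (P (zi p)) (dop p Q r) z).
Proof.
move=> [P0 [B PB]].
pose F (p i : X) (q : (Y * X) * (Y * X)) := binx K p i *
  ((q.1 + q.2 == z)%:R * (P (zi p) q.1 * dpow i (Q (r - zi p + zi i)) q.2)).
have fF : fin (fun q : X * (X * ((Y * X) * (Y * X))) => F q.1 q.2.1 q.2.2).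
  have h1 : finite_set [set s : X | (deg s <= absz B + degm z)%N].
    by apply: (@finite_deg _ _ (absz B + degm z)).
  have h := finite_setX h1 (finite_setX h1 (finite_msplits z)).
  apply: (fin_sub h) => -[p [i q]]; rewrite /F /= !mulf_eq0 !negb_or natb_neq0.
  case/and4P => /binx_neq0 /lex_deg ip /eqP qz /PB + _; rewrite absk_zi => pB.
  have dp : (deg p <= absz B + degm z)%N by rewrite -qz degmD; lia.
  by split=> //=; split=> //=; apply: leq_trans dp.
rewrite /opmul -/(fsum _) (@fsum_inj _ _ _ (fun q : X * X => (zi q.1, q.2))); first last.
- move=> [l i]; rewrite mulf_eq0 negb_or psmulE => /andP[_ /conv_neq0[q [_ Pq _]]].
  have [x|p pl] := @zi_surj _ l; last by exists (p, i); rewrite /= pl.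
  rewrite leNgt; apply/negP => lx; move: Pq.
  by rewrite P0 ?eqxx //; exists x.
- by move=> [p i] [p' i'] [] /zi_inj -> ->.
have E p i : binzm K (zi p) i * psmul (P (zi p))
    (dpow i (Q [ffun x => r x - zi p x + (i x)%:Z])) z = fsum (F p i).
  rewrite binzm_nat // psmulE /conv mulr_fsum_l; apply: eq_fsum => q.
  rewrite /F; congr (_ * (_ * (_ * dpow _ (Q _) _))).
  by apply/ffunP => x; rewrite !ffunE.
transitivity (fsum (fun q : X * X => fsum (F q.1 q.2))).
  by apply: eq_fsum => q; rewrite /= E.
rewrite -(fsum_pair (F := fun p i => fsum (F p i))); last first.
  have := finite_image (fun q => (q.1, q.2.1)) fF.
  apply: sub_finite_set => -[p i] /fsum_neq0[q Fq].
  by exists (p, (i, q)).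
apply: eq_fsum => p; rewrite fsum_exchange; last first.
  exact: (fin_section p (F := fun p q => F p q.1 q.2) fF).
apply: eq_fsum => q; rewrite /F /dop !mulr_fsum_l; apply: eq_fsum => i.
by rewrite dpowE; ring.
Qed.

Lemma addrBDBK (V : zmodType) (x y z : V) : x - y + z - x + y = z.
Proof. by rewrite -addrA [- x + y]addrC addrC addrA -[y - x]opprB addNr add0r. Qed.

(** Write [d^k o P] as [sum_t c_t d^t] with [c_t] in K_y, plus left multiples of the [x_i]. The
    latter stay left multiples after composing with [Q], so row [k] of [P o Q] combines the rows of
    [Q] with the coefficients [c_t]. The proof verifies this on coefficients. *)
Lemma mat_opmul P Q k l e : is_Dsym P ->
  mat (opmul P Q) k l e = mmul (matx P) (mat Q) k l e.
Proof.
move=> DP; have [P0 [B PB]] := DP.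
(* The contribution of the term [y^u x^a d^p] of [P], with [q = (u, v)]: modulo [(x)], [d^k o x^a]
   is [ff k a d^(k-a)], which leaves row [k - a + p] of [Q]. *)
pose F p (q : Y * Y) a := (q.1 + q.2 == e)%:R *
  (ff K k a * (P (zi p) (q.1, a) * mat Q (subx k a + p) l q.2)).
have finD : finite_set ([set p : X | (deg p <= absz B + (deg e + deg k))%N] `*`
    ([set q : Y * Y | q.1 + q.2 = e] `*` [set a : X | lex a k])).
  apply: finite_setX; first exact: (@finite_deg _ _ (absz B + (deg e + deg k))).
  apply: finite_setX; first exact: finite_splits.
  exact: (@finite_lex _ _ k).
have fF : fin (fun q : X * ((Y * Y) * X) => F q.1 q.2.1 q.2.2).
  apply: (fin_sub finD) => -[p [[u v] a]]; rewrite /F /= !mulf_eq0 !negb_or natb_neq0.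
  case/and4P => /eqP uv /ff_neq0 ak /PB + _; rewrite absk_zi degmE /= => pB.
  split=> //=; have := lex_deg ak; have := degD u v; rewrite uv; lia.
transitivity (fsum (fun p => fsum (fun q => fsum (F p q)))); last first.
  (* Reindexing by [t = k - a + p] produces the columns of row [k] of [P]; where [t - k + a] has a
     negative coordinate, the coefficient of [P] is 0. *)
  pose G t (q : Y * Y) a := (q.1 + q.2 == e)%:R *
    (ff K k a * P (zi t - zi k + zi a) (q.1, a) * mat Q t l q.2).
  pose h (q : X * ((Y * Y) * X)) := (subx k q.2.2 + q.1, q.2).
  have EF q : lex q.2.2 k -> G (h q).1 (h q).2.1 (h q).2.2 = F q.1 q.2.1 q.2.2.
    case: q => p [[u v] a] /= ak; rewrite /F /G /= ziD zi_subx //.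
    by rewrite addrBDBK -mulrA.
  have covG q : G q.1 q.2.1 q.2.2 != 0 -> exists q', h q' = q.
    case: q => t [[u v] a]; rewrite /G /= !mulf_eq0 !negb_or natb_neq0.
    case/and3P => _ /andP[/ff_neq0 ak Pt] _.
    have [x|p pt] := @zi_surj _ (zi t - zi k + zi a).
      rewrite leNgt; apply/negP => tx; move: Pt.
      by rewrite P0 ?eqxx //; exists x.
    exists (p, ((u, v), a)); rewrite /h /=; congr (_, _); apply: zi_inj.
    by rewrite ziD zi_subx // pt !addrA addrBDBK.
  have EGF : (fun q => G q.1 q.2.1 q.2.2) \o h =1 (fun q => F q.1 q.2.1 q.2.2).
    move=> q; have [/EF //|ak] := boolP (lex q.2.2 k).
    have z0 : ff K k q.2.2 = 0 by apply/eqP; apply: contraNT ak => /ff_neq0.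
    by rewrite /G /F /= z0 !mul0r !mulr0.
  have fG : fin (fun q : X * ((Y * Y) * X) => G q.1 q.2.1 q.2.2).
    by apply: (fin_inj covG); rewrite (funext EGF).
  rewrite fsum_triple // -(eq_fsum EGF) -fsum_inj //; last first.
    move=> [p q] [p' q'] [] E qq; move: E; rewrite qq ![subx _ _ + _]addrC.
    by move=> /addxI ->.
  rewrite -(fsum_triple (F := G)) //; apply: eq_fsum => t; apply: eq_fsum => q.
  by rewrite /G /matx /mat -mulr_fsum_l mulr_fsum_r.
pose H j p := ff K k j * conv (P (zi p)) (dop p Q (l - zi k + zi j)) (e, j).
transitivity (fsum (fun j => fsum (H j))).
  by apply: eq_fsum => j; rewrite opmul_Dsym // mulr_fsum_l.
rewrite fsum_exchange; last first.
  have h1 : finite_set [set j : X | lex j k] by apply: (@finite_lex _ _ k).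
  have h2 : finite_set [set p : X | (deg p <= absz B + (deg e + deg k))%N].
    exact: (@finite_deg _ _ (absz B + (deg e + deg k))).
  apply: (fin_sub (finite_setX h1 h2)) => -[j p]; rewrite /H /= mulf_eq0 negb_or.
  case/andP=> /ff_neq0 jk /conv_neq0[[u v] /= [uv /PB pB _]]; split=> //=.
  move: pB; have := degmD u v; rewrite uv absk_zi (degmE (e, j)) /=.
  have := lex_deg jk; lia.
apply: eq_fsum => p.
pose T := ((Y * Y) * (X * X))%type.
(* The [x]-exponent [j] of the product splits as [a + s], with [a] from [P] and [s] from [d^p o Q].
   Summing over [s] gives row [k - a] of [d^p o Q], which is row [k - a + p] of [Q]. *)
pose G (q : Y * Y) (a s : X) := (q.1 + q.2 == e)%:R * (ff K k (a + s) *
  (P (zi p) (q.1, a) * dop p Q (l - zi k + zi (a + s)) (q.2, s))).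
pose U (q : X * ((Y * X) * (Y * X))) := ff K k q.1 * ((q.2.1 + q.2.2 == (e, q.1))%:R *
  (P (zi p) q.2.1 * dop p Q (l - zi k + zi q.1) q.2.2)).
pose h (q : T) : X * ((Y * X) * (Y * X)) :=
  (q.2.1 + q.2.2, ((q.1.1, q.2.1), (q.1.2, q.2.2))).
have cov q : U q != 0 -> exists q', h q' = q.
  case: q => j [[u a] [v s]]; rewrite /U /= !mulf_eq0 !negb_or natb_neq0.
  by case/and3P => _ /eqP [_ <-] _; exists ((u, v), (a, s)).
have EU : U \o h =1 (fun q => G q.1 q.2.1 q.2.2).
  move=> [[u v] [a s]]; rewrite /U /G /=.
  have -> : ((u, a) + (v, s) == (e, a + s)) = (u + v == e).
    by apply/eqP/eqP => [[]|<-].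
  by rewrite mulrCA.
have fG : fin (fun q : T => G q.1 q.2.1 q.2.2).
  have h1 : finite_set [set a : X | lex a k] by apply: (@finite_lex _ _ k).
  apply: (fin_sub (finite_setX (finite_splits e) (finite_setX h1 h1))).
  move=> [[u v] [a s]]; rewrite /G /= !mulf_eq0 !negb_or natb_neq0.
  case/and3P=> /eqP uv /ff_neq0 /lexP ask _; split=> //=; split=> /=.
    by apply/lexP => i; apply: leq_trans (ask i); rewrite addxE leq_addr.
  by apply/lexP => i; apply: leq_trans (ask i); rewrite addxE leq_addl.
have fU : fin U by apply: (fin_inj cov); rewrite (funext EU).
transitivity (fsum U).
  have UE : U = fun q => U (q.1, q.2) by apply/funext => -[].
  rewrite [in RHS]UE -(fsum_pair (F := fun j q => U (j, q))); last by rewrite -UE.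
  by apply: eq_fsum => j; rewrite /H /conv mulr_fsum_l.
rewrite (fsum_inj (h := h)) //; last by move=> [[? ?] [? ?]] [[? ?] [? ?]] [_ -> -> -> ->].
rewrite (eq_fsum EU) -(fsum_triple (F := G)) //; apply: eq_fsum => q.
apply: eq_fsum => a; rewrite /G /F -mulr_fsum_l; congr (_ * _).
have [ak|ak] := boolP (lex a k); last first.
  have z0 : ff K k a = 0 by apply/eqP; apply: contraNT ak => /ff_neq0.
  by rewrite z0 mul0r; apply: fsum0 => s; rewrite ffD z0 !mul0r.
rewrite -mat_dop /mat !mulr_fsum_l; apply: eq_fsum => s; rewrite ffD zi_subx // ziD.
have -> : l - (zi k - zi a) + zi s = l - zi k + (zi a + zi s).
  by rewrite opprB [zi a - _]addrC !addrA.
by ring.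
Qed.

End Product.

(** * Right multiplication by operators free of [x], and associativity *)

Section Associativity.
Variables (K : fieldType) (m n : nat).
Hypothesis charK0 : [pchar K] =i pred0.
Local Notation X := {ffun 'I_n -> nat}.
Local Notation Z := {ffun 'I_n -> int}.
Local Notation Y := {ffun 'I_m -> nat}.
Local Notation op := (op K m n).
Local Notation ps := (ps K m n).
Local Notation mon := (mon m n).
Implicit Types (P Q S f g : op) (k j a b p t : X) (l r : Z) (e u v : Y).

(* The Toeplitz matrix of right multiplication by [f]. *)
Definition tpl f r l e : K := f (l - r) (e, 0).

Lemma ffun_cst0 (I : finType) : [ffun=> 0%N] = 0 :> {ffun I -> nat}.
Proof. by apply/ffunP => i; rewrite !ffunE. Qed.

Lemma const_coef0 f r e j : const_coef f -> f r (e, j) != 0 -> j = 0.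
Proof.
move=> cf fr; apply/eqP; apply: contraNT fr => j0.
by rewrite cf // ffun_cst0.
Qed.

(** Derivatives of coefficients free of [x] vanish, so only the underived term of the Leibniz rule
    survives and the [x]-exponent [j] is left untouched. *)
Lemma opmul_const S f r e j : const_coef f ->
  opmul S f r (e, j) =
  fsum (fun p : Z => conv (fun u => S p (u, j)) (fun v => f (r - p) (v, 0)) e).
Proof.
move=> cf; rewrite /opmul -/(fsum _) (@fsum_inj _ _ _ (fun p : Z => (p, 0 : X))).
- apply: eq_fsum => p; rewrite /= binzm0 mul1r psmulE /conv.
  rewrite (@fsum_inj _ _ _ (fun q : Y * Y => ((q.1, j), (q.2, 0 : X)))).
  + apply: eq_fsum => -[u v]; rewrite /comp dpowE /= addr0 ff0 mul1r.
    have -> : ((u, j) + (v, 0) == (e, j) :> Y * X) = (u + v == e).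
      by apply/eqP/eqP => [[]|<-] //; congr (_, _); rewrite addr0.
    congr (_ * (_ * f _ _)); apply/ffunP => i; rewrite !ffunE addr0 //.
  + by move=> [u v] [u' v'] [-> ->].
  + move=> [[u a] [v s]]; rewrite dpowE /= addr0 ff0 mul1r.
    rewrite !mulf_eq0 !negb_or natb_neq0 => /and3P[/eqP[_ aj] _ /(const_coef0 cf) s0].
    by exists (u, v); rewrite /= -aj s0 addr0.
- by move=> p p' [].
- move=> [p i]; rewrite mulf_eq0 negb_or psmulE => /andP[_ /conv_neq0[[z w] [_ _]]].
  rewrite dpowE mulf_eq0 negb_or => /andP[_ /(const_coef0 cf)] /eqP /=.
  rewrite -deg_eq0 degD addn_eq0 !deg_eq0 => /andP[_ /eqP ->].
  by exists p.
Qed.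

Lemma subzE l r (i : 'I_n) : (l - r) i = l i - r i.
Proof. by rewrite !ffunE. Qed.

Lemma int_bound l : exists L : nat, forall i : 'I_n, (absz (l i) <= L)%N.
Proof. by exists (\sum_i absz (l i))%N => i; rewrite (bigD1 i) //= leq_addr. Qed.

(** The other coordinates sum to no less than [- n * N], so each coordinate is at most
    [N + n * N]. *)
Lemma finite_box (D : set Z) (N : nat) :
  (forall r, D r -> (forall i, - N%:Z <= r i) /\ absk r <= N%:Z) -> finite_set D.
Proof.
move=> DN; apply: (@finite_ffun_int _ _ (N + n * N)) => r /DN[lo hi].
suff G (i : 'I_n) : `|r i| <= (N + n * N)%N%:Z by exact: G.
have H : absk r >= r i - (n * N)%N%:Z.
  rewrite /absk (bigD1 i) //= lerD2l.
  have -> : - (n * N)%N%:Z = \sum_(x < n) (- N%:Z).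
    by rewrite sumr_const card_ord mulNrn -mulr_natr natz; lia.
  rewrite [leLHS](bigD1 i) //= -[leRHS]add0r lerD ?oppr_le0 //.
  by apply: ler_sum => x _.
by move: H (lo i) hi; move: (n * N)%N (r i) (absk r); lia.
Qed.

Lemma hatPi_bound S : is_hatPi S -> exists B : nat, forall r (z : Y * X), S r z != 0 ->
  (forall i, ~~ is_last i -> 0 <= r i) /\ absk r <= (B + degm z)%N%:Z.
Proof.
move=> [S0 [B SB]]; exists (absz B) => r z Sr; split; last by have := SB _ _ Sr; lia.
move=> i li; rewrite leNgt; apply/negP => ri; move: Sr.
by rewrite S0 ?eqxx //; exists i.
Qed.

(** The upper bound on the last coordinate separates [Pi_n] from [hat Pi_n]. In [S o f] it bounds
    from below the power of [d_n] taken from [S], which makes the product a finite sum. *)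
Lemma VPi_bound f : in_VPi f -> exists N : nat, forall r e j, f r (e, j) != 0 ->
  [/\ forall i, ~~ is_last i -> 0 <= r i, forall i, is_last i -> r i <= N%:Z,
      absk r <= (N + deg e)%N%:Z & j = 0].
Proof.
move=> [[Pf [N fN]] cf]; have [B fB] := hatPi_bound Pf.
exists (absz N + B)%N => r e j fr; have [nl ab] := fB _ _ fr.
have j0 := const_coef0 cf fr; split=> // [i li|].
  have : r i <= N by rewrite leNgt; apply/negP => Ni; move: fr; rewrite (fN _ i) ?eqxx.
  by lia.
by move: ab; rewrite degmE /= j0 deg0; lia.
Qed.

Lemma mat_hatPi S : is_hatPi S <-> exists B : nat, forall k l e, mat S k l e != 0 ->
  (forall i, ~~ is_last i -> 0 <= l i) /\ absk l <= (B + deg e + deg k)%N%:Z.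
Proof.
split=> [[S0 [B SB]]|[B H]].
  exists (absz B) => k l e Sk; split; last by have := (ord_le_mat charK0 S B).1 SB _ _ _ Sk; lia.
  exact: (nonneg_mat charK0 (fun i => ~~ is_last i) S).1 S0 _ _ _ Sk.
split.
  by apply/(nonneg_mat charK0 (fun i => ~~ is_last i)) => k l e /H[].
by exists B%:Z; apply/(ord_le_mat charK0) => k l e /H[_]; lia.
Qed.

Lemma Dsym_nonneg P : (forall k : Z, (exists i, k i < 0) -> P k = 0) <->
  (forall k l e, mat P k l e != 0 -> forall i, 0 <= l i).
Proof.
have h := nonneg_mat charK0 (fun=> true) P; split=> H.
  move=> k l e Pk i; apply: (h.1 _ _ _ _ Pk) => // r [x [_ rx]].
  by apply: H; exists x.
move=> r [x rx]; apply: h.2; last by exists x.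
by move=> k l e Pk i _; apply: H Pk i.
Qed.

Lemma mat_Dsym P : is_Dsym P <-> exists B : nat, forall k l e, mat P k l e != 0 ->
  (forall i, 0 <= l i) /\ absk l <= (B + deg e + deg k)%N%:Z.
Proof.
split=> [[P0 [B PB]]|[B H]].
  exists (absz B) => k l e Pk; split; last by have := (ord_le_mat charK0 P B).1 PB _ _ _ Pk; lia.
  by apply: (Dsym_nonneg P).1 P0 _ _ _ Pk.
split; first by apply/Dsym_nonneg => k l e /H[].
by exists B%:Z; apply/(ord_le_mat charK0) => k l e /H[_]; lia.
Qed.

Lemma matx_Dsym P : is_Dsym P -> exists B : nat, forall k t e, matx P k t e != 0 ->
  (deg t <= B + deg e + deg k)%N.
Proof.
move=> /mat_Dsym[B H]; exists B => k t e /H[_]; rewrite absk_zi; lia.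
Qed.

(** Right multiplication by an operator free of [x] commutes with reduction modulo [(x)], so it acts
    on each row separately. *)
Lemma mat_opmul_const S f k l e : is_hatPi S -> in_VPi f ->
  mat (opmul S f) k l e = mmul (mat S) (tpl f) k l e.
Proof.
move=> /hatPi_bound[B SB] Vf; have [N fN] := VPi_bound Vf; have cf := Vf.2.
pose F j r (q : Y * Y) := ff K k j * ((q.1 + q.2 == e)%:R *
   (S (r - zi k + zi j) (q.1, j) * tpl f r l q.2)).
have fF : fin (fun q : X * (Z * (Y * Y)) => F q.1 q.2.1 q.2.2).
  have h1 : finite_set [set j : X | lex j k] by apply: (@finite_lex _ _ k).
  (* [C] adds up all the bounds involved. The last coordinate of [r] is at least that of [l] minus
     [N], the others are nonnegative since [j <= k], and the order of [S] bounds [absk r] from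
     above. *)
  have [L lL] := int_bound l; pose C := (deg k + N + B + deg e + L)%N.
  have h2 : finite_set [set r : Z | (forall i, - C%:Z <= r i) /\ absk r <= C%:Z].
    exact: (@finite_box _ C).
  apply: (fin_sub (finite_setX h1 (finite_setX h2 (finite_splits e)))).
  move=> [j [r [u v]]]; rewrite /F /= !mulf_eq0 !negb_or natb_neq0.
  case/and4P=> /ff_neq0 jk /eqP uv /SB[nl ab] /fN[nl' la _ _].
  split=> //=; split=> //=; have du := degD u v; rewrite uv in du.
  have dj := lex_deg jk; split.
    move=> i; have [lasti|nlasti] := boolP (is_last i).
      have := la i lasti; rewrite subzE /C; have := lL i; lia.
    have := nl i nlasti; rewrite shiftE; have := lex_ord jk i; have := leq_deg_ord k i.
    rewrite /C; lia.
  by move: ab; rewrite !abskD abskN !absk_zi degmE /= /C; lia.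
transitivity (fsum (fun j => fsum (fun r => fsum (F j r)))).
  apply: eq_fsum => j; rewrite opmul_const // mulr_fsum_l.
  rewrite (@fsum_inj _ _ _ (fun r => r - zi k + zi j)).
  - apply: eq_fsum => r; rewrite /= /F -mulr_fsum_l; congr (_ * _).
    apply: eq_fsum => q; rewrite /tpl.
    have -> // : l - zi k + zi j - (r - zi k + zi j) = l - r.
    by rewrite -[l - _ + _]addrA -[r - _ + _]addrA [r + _]addrC addrKA.
  - by move=> r r' /addIr /addIr.
  - by move=> r _; exists (r - zi j + zi k); rewrite addrK subrK.
transitivity (fsum (fun r => fsum (fun q => fsum (fun j => F j r q)))).
  pose G r (q : Y * Y) j := F j r q.
  pose h (q : Z * ((Y * Y) * X)) := (q.2.2, (q.1, q.2.1)).
  rewrite fsum_triple // (fsum_inj (h := h)); first last.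
  - by move=> [j [r q]] _; exists (r, (q, j)).
  - by move=> [r [q j]] [r' [q' j']] [-> -> ->].
  rewrite -(fsum_triple (F := G)) //.
  apply: (@fin_inj _ _ _ (fun q : X * (Z * (Y * Y)) => (q.2.1, (q.2.2, q.1)))).
    by move=> [r [q j]] _; exists (j, (r, q)).
  exact: fF.
apply: eq_fsum => r; apply: eq_fsum => q; rewrite /mat.
rewrite mulr_fsum_r mulr_fsum_l; apply: eq_fsum => j.
by rewrite /F [LHS]mulrCA; congr (_ * _); rewrite mulrA.
Qed.

Lemma tpl_opmul f g r l e : in_VPi g ->
  tpl (opmul f g) r l e = mmul (tpl f) (tpl g) r l e.
Proof.
move=> [_ cg]; rewrite /tpl opmul_const // (@fsum_inj _ _ _ (fun s => s - r)).
- apply: eq_fsum => s; apply: eq_conv => // v /=.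
  by rewrite /tpl opprB addrA subrK.
- by move=> s s' /addIr.
- by move=> s _; exists (s + r); rewrite addrK.
Qed.

Lemma ord_le_opmul P S B C : is_Dsym P -> ord_le P B -> ord_le S C ->
  ord_le (opmul P S) (B + C).
Proof.
move=> DP /(ord_le_mat charK0) PB /(ord_le_mat charK0) SC.
apply/(ord_le_mat charK0) => k l e; rewrite mat_opmul //.
case/mmul_neq0 => t [u [v [uv /PB + /SC]]]; rewrite -uv degD absk_zi; lia.
Qed.

Lemma ord_le_opmul_const S f B C : is_hatPi S -> in_VPi f ->
  ord_le S B -> ord_le f C -> ord_le (opmul S f) (B + C).
Proof.
move=> PS Vf /(ord_le_mat charK0) SB fC.
apply/(ord_le_mat charK0) => k l e; rewrite mat_opmul_const //.
case/mmul_neq0 => r [u [v [uv /SB + /fC]]]; rewrite -uv degD.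
by rewrite abskD abskN degmE /= deg0; lia.
Qed.

Lemma Dsym_opmul P Q : is_Dsym P -> is_Dsym Q -> is_Dsym (opmul P Q).
Proof.
move=> DP DQ; have [[_ [B PB]] [Q0 [C QC]]] := (DP, DQ).
split; last by exists (B + C); apply: ord_le_opmul.
apply/Dsym_nonneg => k l e; rewrite mat_opmul //.
by case/mmul_neq0 => t [u [v [_ _]]]; apply: (Dsym_nonneg Q).1.
Qed.

Lemma hatPi_opmul P S : is_Dsym P -> is_hatPi S -> is_hatPi (opmul P S).
Proof.
move=> DP PS; have [[_ [B PB]] [S0 [C SC]]] := (DP, PS).
split; last by exists (B + C); apply: ord_le_opmul.
apply/(nonneg_mat charK0 (fun i => ~~ is_last i)) => k l e; rewrite mat_opmul //.
case/mmul_neq0 => t [u [v [_ _]]].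
exact: (nonneg_mat charK0 (fun i => ~~ is_last i) S).1.
Qed.

Lemma hatPi_opmul_const S f : is_hatPi S -> in_VPi f -> is_hatPi (opmul S f).
Proof.
move=> PS Vf; have [[S0 [B SB]] [[[f0 [C fC]] _] _]] := (PS, Vf).
split; last by exists (B + C); apply: ord_le_opmul_const.
apply/(nonneg_mat charK0 (fun i => ~~ is_last i)) => k l e; rewrite mat_opmul_const //.
case/mmul_neq0 => r [u [v [_ Sr fr]]] i li.
have := (nonneg_mat charK0 (fun i => ~~ is_last i) S).1 S0 _ _ _ Sr i li.
have [N fN] := VPi_bound Vf; have [/(_ i li)] := fN _ _ _ fr.
rewrite subzE; lia.
Qed.

Lemma opmulA P Q S : is_Dsym P -> is_Dsym Q ->
  opmul P (opmul Q S) = opmul (opmul P Q) S.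
Proof.
move=> DP DQ; have DPQ := Dsym_opmul DP DQ.
have [[B PB] [C QC]] := (matx_Dsym DP, matx_Dsym DQ).
apply: (mat_inj charK0) => k l e; rewrite !mat_opmul //.
transitivity (mmul (matx P) (mmul (matx Q) (mat S)) k l e).
  by apply: eq_fsum => t; apply: eq_conv => // v; rewrite mat_opmul.
transitivity (mmul (mmul (matx P) (matx Q)) (mat S) k l e); last first.
  by apply: eq_fsum => t; apply: eq_conv => // v; rewrite /matx mat_opmul.
apply: mmulA.
have h : finite_set [set t : X | (deg t <= B + C + deg e + deg k)%N].
  exact: (@finite_deg _ _ (B + C + deg e + deg k)).
apply: (finite_pair h h) => -[s t] /= [u [v [w [uvw /PB Ps /QC Qs _]]]].
by rewrite -uvw !degD; lia.
Qed.

Lemma opmulA_const P S f : is_Dsym P -> is_hatPi S -> in_VPi f ->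
  opmul P (opmul S f) = opmul (opmul P S) f.
Proof.
move=> DP PS Vf; have PPS := hatPi_opmul DP PS.
have [[B PB] [C SC]] := (matx_Dsym DP, (mat_hatPi S).1 PS).
have [N fN] := VPi_bound Vf.
apply: (mat_inj charK0) => k l e; rewrite mat_opmul // mat_opmul_const //.
transitivity (mmul (matx P) (mmul (mat S) (tpl f)) k l e).
  by apply: eq_fsum => t; apply: eq_conv => // v; rewrite mat_opmul_const.
transitivity (mmul (mmul (matx P) (mat S)) (tpl f) k l e); last first.
  by apply: eq_fsum => t; apply: eq_conv => // v; rewrite mat_opmul.
apply: mmulA; have [L lL] := int_bound l.
have h : finite_set [set t : X | (deg t <= B + deg e + deg k)%N].
  exact: (@finite_deg _ _ (B + deg e + deg k)).
pose M := (B + C + N + L + deg e + deg k)%N.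
have h2 : finite_set [set r : Z | (forall i, - M%:Z <= r i) /\ absk r <= M%:Z].
  exact: (@finite_box _ M).
apply: (finite_pair h h2) => -[t r] /= [u [v [w [uvw /PB Pt /SC[nl ab] /fN[_ la _ _]]]]].
have := degD (u + v) w; have := degD u v; rewrite uvw => d1 d2.
split; first by lia.
split; last by rewrite /M; lia.
move=> i; have [lasti|nlasti] := boolP (is_last i).
  have := la i lasti; rewrite subzE /M; have := lL i; lia.
have := nl i nlasti; rewrite /M; lia.
Qed.

(** The bounds [N'] and [N] on powers of [d_n] in [g] and [f] bound the last coordinates of the
    intermediate indices [s] and then [r] from below; the orders of [f] and [S] bound their sums
    from above. *)
Lemma opmulA_const2 S f g : is_hatPi S -> in_VPi f -> in_VPi g ->
  in_VPi (opmul f g) -> opmul S (opmul f g) = opmul (opmul S f) g.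
Proof.
move=> PS Vf Vg Vfg; have PSf := hatPi_opmul_const PS Vf.
have [C SC] := (mat_hatPi S).1 PS.
have [[N fN] [N' gN]] := (VPi_bound Vf, VPi_bound Vg).
apply: (mat_inj charK0) => k l e; rewrite !mat_opmul_const //.
transitivity (mmul (mat S) (mmul (tpl f) (tpl g)) k l e).
  by apply: eq_fsum => t; apply: eq_conv => // v; rewrite tpl_opmul.
transitivity (mmul (mmul (mat S) (tpl f)) (tpl g) k l e); last first.
  by apply: eq_fsum => t; apply: eq_conv => // v; rewrite mat_opmul_const.
apply: mmulA; have [L lL] := int_bound l.
pose M := (C + N + N' + L + deg e + deg k)%N.
have h : finite_set [set r : Z | (forall i, - M%:Z <= r i) /\ absk r <= M%:Z].
  exact: (@finite_box _ M).
apply: (finite_pair h h) => -[r s] /= [u [v [w [uvw /SC[nl ab] /fN[nl' la ab' _] /gN[_ la' _ _]]]]].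
have := degD (u + v) w; have := degD u v; rewrite uvw => d1 d2.
split; split.
- move=> i; have [lasti|nlasti] := boolP (is_last i).
    have := la i lasti; have := la' i lasti; rewrite !subzE /M; have := lL i; lia.
  have := nl i nlasti; rewrite /M; lia.
- by rewrite /M; lia.
- move=> i; have [lasti|nlasti] := boolP (is_last i).
    have := la' i lasti; rewrite !subzE /M; have := lL i; lia.
  have := nl' i nlasti; have := nl i nlasti; rewrite subzE /M; lia.
- by move: ab'; rewrite abskD abskN /M; lia.
Qed.

End Associativity.

(** * Bilinearity and the unit *)

Section Linearity.
Variables (K : fieldType) (m n : nat).
Hypothesis charK0 : [pchar K] =i pred0.
Local Notation X := {ffun 'I_n -> nat}.
Local Notation Z := {ffun 'I_n -> int}.
Local Notation Y := {ffun 'I_m -> nat}.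
Local Notation op := (op K m n).
Implicit Types (P Q S f g : op) (k j a b p t : X) (l r : Z) (e u v : Y).

Lemma fin_mmul_Dsym P S k l e : is_Dsym P ->
  fin (fun t => conv (matx P k t) (mat S t l) e).
Proof.
move=> /(matx_Dsym charK0)[B PB].
have h : finite_set [set t : X | (deg t <= B + deg e + deg k)%N].
  exact: (@finite_deg _ _ (B + deg e + deg k)).
apply: (fin_sub h) => t /conv_neq0[[u v] /= [uv /PB + _]].
by rewrite -uv degD; lia.
Qed.

Lemma Dsym_opadd P Q : is_Dsym P -> is_Dsym Q -> is_Dsym (opadd P Q).
Proof.
move=> /(mat_Dsym charK0)[B PB] /(mat_Dsym charK0)[C QC].
apply/(mat_Dsym charK0); exists (B + C)%N => k l e; rewrite mat_opadd.
have [-> |/PB[nl ab] _] := eqVneq (mat P k l e) 0.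
  by rewrite add0r => /QC[nl ab]; split=> //; lia.
by split=> //; lia.
Qed.

Lemma Dsym_opscale c P : is_Dsym P -> is_Dsym (opscale c P).
Proof.
move=> /(mat_Dsym charK0)[B PB]; apply/(mat_Dsym charK0); exists B => k l e.
by rewrite mat_opscale mulf_eq0 negb_or => /andP[_ /PB].
Qed.

Lemma opmulDl P Q S : is_Dsym P -> is_Dsym Q ->
  opmul (opadd P Q) S = opadd (opmul P S) (opmul Q S).
Proof.
move=> DP DQ; apply: (mat_inj charK0) => k l e.
rewrite mat_opadd !(mat_opmul charK0) //; last exact: Dsym_opadd.
rewrite /mmul -fsumD; try exact: fin_mmul_Dsym.
apply: eq_fsum => t; rewrite -convDl; apply: eq_conv => // u.
by rewrite /matx mat_opadd.
Qed.

Lemma opmulZl c P S : is_Dsym P -> opmul (opscale c P) S = opscale c (opmul P S).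
Proof.
move=> DP; apply: (mat_inj charK0) => k l e.
rewrite mat_opscale !(mat_opmul charK0) //; last exact: Dsym_opscale.
rewrite /mmul mulr_fsum_l; apply: eq_fsum => t; rewrite /conv mulr_fsum_l.
by apply: eq_fsum => q; rewrite /matx mat_opscale -mulrA mulrCA.
Qed.

Lemma fin_opmul_const S f r e j : is_hatPi S -> in_VPi f ->
  fin (fun p : Z => conv (fun u => S p (u, j)) (fun v => f (r - p) (v, 0)) e).
Proof.
move=> /(hatPi_bound)[B SB] /VPi_bound[N fN]; have [L rL] := int_bound r.
pose M := (B + N + L + deg e + deg j)%N.
have h : finite_set [set p : Z | (forall i, - M%:Z <= p i) /\ absk p <= M%:Z].
  exact: (@finite_box _ _ M).
apply: (fin_sub h) => p /conv_neq0[[u v] /= [uv /SB[nl ab] /fN[_ la _ _]]].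
have := degD u v; rewrite uv => d; split; last by move: ab; rewrite degmE /= /M; lia.
move=> i; have [lasti|nlasti] := boolP (is_last i).
  have := la i lasti; rewrite subzE /M; have := rL i; lia.
have := nl i nlasti; rewrite /M; lia.
Qed.

Lemma opmulDr S f g : is_hatPi S -> in_VPi f -> in_VPi g -> in_VPi (opadd f g) ->
  opmul S (opadd f g) = opadd (opmul S f) (opmul S g).
Proof.
move=> PS Vf Vg Vfg; apply/funext => r; apply/funext => -[e j].
have [[[_ cf] [_ cg]] [_ cfg]] := (Vf, Vg, Vfg).
rewrite /opadd -/(opadd f g) !opmul_const // -fsumD; try exact: fin_opmul_const.
apply: eq_fsum => p; rewrite /conv -fsumD.
- by apply: eq_fsum => q; rewrite -mulrDr -mulrDr.
- exact: (fin_conv (fun u => S p (u, j)) (fun v => f (r - p) (v, 0))).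
- exact: (fin_conv (fun u => S p (u, j)) (fun v => g (r - p) (v, 0))).
Qed.

Lemma opmulZr c S f : in_VPi f -> in_VPi (opscale c f) ->
  opmul S (opscale c f) = opscale c (opmul S f).
Proof.
move=> Vf Vcf; apply/funext => r; apply/funext => -[e j].
have [[_ cf] [_ ccf]] := (Vf, Vcf).
rewrite /opscale -/(opscale c f) !opmul_const // mulr_fsum_l.
apply: eq_fsum => p; rewrite /conv mulr_fsum_l.
by apply: eq_fsum => q; rewrite /opscale [RHS]mulrCA; congr (_ * _); rewrite mulrCA.
Qed.

Lemma conv_delta_l (a b : Y -> K) e : (forall u, u != 0 -> a u = 0) ->
  conv a b e = a 0 * b e.
Proof.
move=> a0; rewrite /conv (@fsum_single _ _ (0, e)) /= ?add0r ?eqxx ?mul1r //.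
move=> [u v] ne; have [uv|] := eqVneq (u + v) e; last by rewrite /= mul0r.
have [u0|/a0 /= ->] := eqVneq u 0; last by rewrite mul0r mulr0.
by move: ne; rewrite -uv u0 add0r eqxx.
Qed.

Lemma conv_delta_r (a b : Y -> K) e : (forall u, u != 0 -> b u = 0) ->
  conv a b e = a e * b 0.
Proof.
move=> b0; rewrite /conv (@fsum_single _ _ (e, 0)) /= ?addr0 ?eqxx ?mul1r //.
move=> [u v] ne; have [uv|] := eqVneq (u + v) e; last by rewrite /= mul0r.
have [v0|/b0 /= ->] := eqVneq v 0; last by rewrite mulr0 mulr0.
by move: ne; rewrite -uv v0 addr0 eqxx.
Qed.

Lemma oponeE l (z : Y * X) : @opone K m n l z = ((l == 0) && (z == 0))%:R.
Proof.
rewrite /opone /psone degmE addn_eq0 !deg_eq0.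
have -> : [ffun=> 0%:Z] = 0 :> Z by apply/ffunP => i; rewrite !ffunE.
by case: (l == 0) => //=; case: z => u j /=; rewrite xpair_eqE; case: ifP.
Qed.

Lemma mat_opone k l e : mat (@opone K m n) k l e = ((l == zi k) && (e == 0))%:R.
Proof.
rewrite /mat (@fsum_single _ _ 0).
  rewrite ff0 mul1r zi0 addr0 oponeE subr_eq0; congr (_ && _)%:R.
  by rewrite xpair_eqE eqxx andbT.
by move=> j j0; rewrite oponeE xpair_eqE (negPf j0) !andbF mulr0.
Qed.

Lemma Dsym_opone : is_Dsym (@opone K m n).
Proof.
apply/(mat_Dsym charK0); exists 0%N => k l e; rewrite mat_opone natb_neq0.
case/andP=> /eqP -> /eqP ->; rewrite absk_zi deg0 !add0n; split=> // i.
by rewrite ffunE.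
Qed.

Lemma opmul1r S : is_hatPi S -> opmul S (@opone K m n) = S.
Proof.
move=> PS; apply/funext => r; apply/funext => -[e j].
have c1 : const_coef (@opone K m n).
  move=> l [u i] /=; rewrite ffun_cst0 oponeE xpair_eqE => /negPf ->.
  by rewrite !andbF.
rewrite opmul_const // (@fsum_single _ _ r).
  rewrite conv_delta_r ?oponeE ?subrr ?eqxx ?mulr1 // => u u0.
  by rewrite oponeE xpair_eqE (negPf u0) andbF.
move=> p pr; apply/eqP; apply: contraNT pr => /conv_neq0[[u v] [_ _]].
by rewrite oponeE natb_neq0 subr_eq0 eq_sym => /andP[].
Qed.

Lemma opmul1l S : opmul (@opone K m n) S = S.
Proof.
apply: (mat_inj charK0) => k l e; rewrite mat_opmul //; last exact: Dsym_opone.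
rewrite /mmul (@fsum_single _ _ k).
  rewrite conv_delta_l ?/matx ?mat_opone ?eqxx ?mul1r // => u u0.
  by rewrite /matx mat_opone (negPf u0) andbF.
move=> t tk; apply: conv0l => u; rewrite /matx mat_opone.
by rewrite (inj_eq (@zi_inj _)) (negPf tk).
Qed.

End Linearity.

(** * The action on a Sato operator, and regularity *)

Section Sato.
Variables (K : fieldType) (m n : nat).
Hypothesis charK0 : [pchar K] =i pred0.
Local Notation X := {ffun 'I_n -> nat}.
Local Notation Z := {ffun 'I_n -> int}.
Local Notation Y := {ffun 'I_m -> nat}.
Local Notation op := (op K m n).
Implicit Types (P Q S f g : op) (k j a b p t : X) (l r : Z) (e u v : Y).

Lemma int_max (D : int -> Prop) (d0 B : int) : D d0 -> (forall d, D d -> d <= B) ->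
  exists2 d, D d & forall d', D d' -> d' <= d.
Proof.
move=> D0 DB; pose E (N : nat) := `[< D (B - N%:Z) >].
have exE : exists N, E N.
  exists (absz (B - d0)); apply/asboolP.
  by have -> : B - (absz (B - d0))%:Z = d0 by have := DB _ D0; lia.
exists (B - (ex_minn exE)%:Z); case: ex_minnP => N /asboolP EN minN //.
move=> d' Dd'; have /minN : E (absz (B - d')).
  by apply/asboolP; have -> : B - (absz (B - d'))%:Z = d' by have := DB _ Dd'; lia.
by have := DB _ Dd'; lia.
Qed.

(* [h <> S], for a family [h] of coefficients over K_y. *)
Definition act (h : X -> Y -> K) S l e : K :=
  fsum (fun t => conv (h t) (mat S t l) e).

Lemma in_F_Dsym f : in_F f -> is_Dsym f.
Proof. by move=> [[[[_ ?] _] _] ?]. Qed.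

(** [f <> S] is row 0 of [f o S], hence row 0 of [f], that is [f] itself, times the matrix of
    [S]. *)
Lemma diamondE f S r e : in_F f ->
  diamond f S r (e, 0) = act (fun t u => f (zi t) (u, 0)) S r e.
Proof.
move=> /in_F_Dsym Df; rewrite /diamond /= ffun_cst0 eqxx -mat0.
rewrite mat_opmul //; apply: eq_fsum => t; apply: eq_conv => // u.
by rewrite /matx mat0.
Qed.

Lemma diamond_neq0 f S r e j : j != 0 -> diamond f S r (e, j) = 0.
Proof. by move=> j0; rewrite /diamond /= ffun_cst0 (negPf j0). Qed.

Lemma in_F_sub f g : in_F f -> (forall r z, g r z != 0 -> f r z != 0) -> in_F g.
Proof.
move=> [[[[f0 [B fB]] [N fN]] cf] f1] gf.
have g0 r z : f r z = 0 -> g r z = 0.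
  by move=> fr; apply/eqP; apply: contraT => /gf; rewrite fr eqxx.
have gr0 r : f r = 0 -> g r = 0.
  by move=> fr; apply/funext => z; apply: g0; rewrite fr.
split; last by move=> r /f1 /gr0.
split; last by move=> r z /(cf r) /g0.
split; last by exists N => r i li /(fN _ _ li) /gr0.
by split; [move=> r /f0 /gr0 | exists B => r z /gf /fB].
Qed.

Lemma sigma_neq0 P mu r z : sigma P mu r z != 0 -> P r z != 0.
Proof. by rewrite /sigma; case: ifP; rewrite ?eqxx. Qed.

Definition dmon k : op := fun r (z : Y * X) => ((r == zi k) && (z == 0))%:R.

Lemma in_F_dmon k : in_F (dmon k).
Proof.
have z1 r : r != zi k -> dmon k r = 0.
  by move=> /negPf rk; apply/funext => z; rewrite /dmon rk.
split; last first.
  move=> r [i ri]; apply: z1; apply: contraTN ri => /eqP ->.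
  by rewrite ffunE -leNgt.
split; last first.
  move=> r [e j] /=; rewrite ffun_cst0 /dmon xpair_eqE => /negPf ->.
  by rewrite !andbF.
split; last first.
  exists (deg k)%:Z => r i _ ri; apply: z1; apply: contraTN ri => /eqP ->.
  by rewrite ffunE -leNgt lez_nat leq_deg_ord.
split.
  move=> r [i [_ ri]]; apply: z1; apply: contraTN ri => /eqP ->.
  by rewrite ffunE -leNgt.
exists (deg k)%:Z => r z; rewrite natb_neq0 => /andP[/eqP -> _].
by rewrite absk_zi; lia.
Qed.

Lemma act_delta k S l e :
  act (fun t u => dmon k (zi t) (u, 0)) S l e = mat S k l e.
Proof.
rewrite /act (@fsum_single _ _ k).
  rewrite conv_delta_l; first by rewrite /dmon !eqxx mul1r.
  by move=> u u0; rewrite /dmon xpair_eqE (negPf u0) andbF.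
move=> t tk; apply: conv0l => u.
by rewrite /dmon (inj_eq (@zi_inj _)) (negPf tk).
Qed.

Lemma in_F_opzero : in_F (@opzero K m n).
Proof. by apply: (in_F_sub (in_F_dmon 0)) => r z; rewrite eqxx. Qed.

Lemma mat_sigma S mu k l e : mat (sigma S mu) k l e =
  (absk l - (deg e)%:Z - (deg k)%:Z == mu)%:R * mat S k l e.
Proof.
rewrite /mat mulr_fsum_l; apply: eq_fsum => j; rewrite mulrCA; congr (_ * _).
rewrite /sigma degmE /= !abskD abskN !absk_zi.
have -> : (absk l - (deg k)%:Z + (deg j)%:Z - (deg e + deg j)%N%:Z == mu) =
          (absk l - (deg e)%:Z - (deg k)%:Z == mu) by apply/eqP/eqP; lia.
by case: eqP; rewrite ?mul1r ?mul0r.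
Qed.

(* The top homogeneous part of [f <> S] is [sigma(f) <> sigma(S)]. *)
Lemma act_sigma f S mu d r e : in_F f -> ord_le f d -> ord_le S mu ->
  act (fun t u => sigma f d (zi t) (u, 0)) (sigma S mu) r e =
  (absk r - (deg e)%:Z == d + mu)%:R * act (fun t u => f (zi t) (u, 0)) S r e.
Proof.
move=> Ff fd /(ord_le_mat charK0) Smu.
rewrite /act mulr_fsum_l; apply: eq_fsum => t; rewrite /conv mulr_fsum_l.
apply: eq_fsum => -[u v] /=; rewrite [RHS]mulrCA.
have [uv|_] := eqVneq (u + v) e; last by rewrite !mul0r.
congr (_ * _); rewrite mat_sigma /sigma degmE /= deg0 addn0 absk_zi.
have [->|f0] := eqVneq (f (zi t) (u, 0)) 0.
  by rewrite if_same !mul0r mulr0.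
have [->|S0] := eqVneq (mat S t r v) 0; first by rewrite !mulr0.
have := fd _ _ f0; have := Smu _ _ _ S0; rewrite degmE /= deg0 addn0 absk_zi.
rewrite -uv degD => le1 le2.
(* The two orders are at most [d] and [mu], so their sum equals [d + mu] exactly when both bounds
   are attained. *)
have -> : (absk r - (deg u + deg v)%N%:Z == d + mu) =
    ((deg t)%:Z - (deg u)%:Z == d) && (absk r - (deg v)%:Z - (deg t)%:Z == mu).
  by apply/eqP/andP => [E|[/eqP E /eqP E']]; [split; apply/eqP; lia | lia].
by case: (_ == d); case: (_ == mu); rewrite /= ?mul0r ?mul1r ?mulr0.
Qed.

(** If [f] had order [d > B], then [sigma(f) <> sigma(S)] would be the part of order [d + mu] of
    [f <> S], which is 0 because [f <> S] has order at most [mu + B]. Regularity then gives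
    [sigma(f) = 0], against the choice of [d]. *)
Lemma regular_ord S mu f B : ord_le S mu -> regular S mu -> in_F f ->
  ord_le (diamond f S) (mu + B) -> ord_le f B.
Proof.
move=> Smu regS Ff fB; apply: contrapT => nfB.
pose D d := exists r z, f r z != 0 /\ absk r - (degm z)%:Z = d.
have [d0 Dd0 d0B] : exists2 d0, D d0 & B < d0.
  apply: contrapT => H; apply: nfB => r z fr; rewrite leNgt; apply/negP => lt.
  by apply: H; exists (absk r - (degm z)%:Z) => //; exists r, z.
have [_ [C fC]] := in_F_Dsym Ff.
have [d [r0 [z0 [fr0 rz0]]] dmax] : exists2 d, D d & forall d', D d' -> d' <= d.
  by apply: (@int_max D d0 C Dd0) => _ [r [z [fr <-]]]; apply: fC.
have fd : ord_le f d by move=> r z fr; apply: dmax; exists r, z.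
have dB : B < d by apply: lt_le_trans d0B _; apply: dmax.
have Fs : in_F (sigma f d) by apply: (in_F_sub Ff) => r z /sigma_neq0.
have /(congr1 (fun P => P r0 z0)) : sigma f d = @opzero K m n.
  apply: regS => //; first exact: in_F_opzero.
  apply/funext => r; apply/funext => -[e j].
  have [->|j0] := eqVneq j 0; last by rewrite !diamond_neq0.
  rewrite !diamondE //; last exact: in_F_opzero.
  rewrite [RHS]fsum0; last by move=> t; apply: conv0l.
  rewrite act_sigma //; have [E|_] := eqVneq (absk r - (deg e)%:Z) (d + mu); last by rewrite mul0r.
  rewrite mul1r -diamondE //; apply/eqP; apply: contraT => /fB.
  by rewrite degmE /= deg0 addn0 E; lia.
by rewrite /sigma rz0 eqxx => /eqP; rewrite (negPf fr0).
Qed.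

End Sato.

(** * Left cancellation: [P o S] determines [P] *)

Section Uniqueness.
Variables (K : fieldType) (m n : nat).
Hypothesis charK0 : [pchar K] =i pred0.
Local Notation X := {ffun 'I_n -> nat}.
Local Notation Z := {ffun 'I_n -> int}.
Local Notation Y := {ffun 'I_m -> nat}.
Local Notation op := (op K m n).
Implicit Types (P Q S f g : op) (k j a b p t : X) (l r : Z) (e u v : Y).

(** The number of monomials of degree at most [N] in [n] variables is the value that [in_Gr]
    prescribes for [H_W(mu + N)]; this coincidence drives the dimension count. *)
Lemma enum_deg_le (N : nat) : exists2 col : 'I_('C(n + N, n)) -> X,
  injective col & forall t, (deg t <= N)%N -> exists c, col c = t.
Proof.
pose T := [set t : n.-tuple 'I_N.+1 | (\sum_(i <- t) i <= N)%N]%SET.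
have HT : #|T| = 'C(n + N, n) by apply: card_partial_ord_partitions.
exists (fun c => [ffun i => nat_of_ord (tnth (enum_val (cast_ord (esym HT) c)) i)]).
  move=> c c' /ffunP E; apply: (@cast_ord_inj _ _ (esym HT)); apply: enum_val_inj.
  by apply: eq_from_tnth => i; apply: ord_inj; have := E i; rewrite !ffunE.
move=> t tN; have tI i : (t i < N.+1)%N by rewrite ltnS; apply: leq_trans (leq_deg t i) tN.
pose tt := [tuple (Ordinal (tI i)) | i < n].
have ttT : tt \in T.
  rewrite inE big_tuple; apply: leq_trans tN; rewrite leq_eqVlt; apply/orP; left.
  by apply/eqP; apply: eq_bigr => i _; rewrite tnth_mktuple.
exists (cast_ord HT (enum_rank_in ttT tt)); apply/ffunP => i.
by rewrite ffunE cast_ordK enum_rankK_in // tnth_mktuple.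
Qed.

Lemma foldr_opaddE (I : Type) (s : seq I) (c : I -> K) (v : I -> op) r z :
  foldr (fun i acc => opadd (opscale (c i) (v i)) acc) (@opzero K m n) s r z =
  \sum_(i <- s) c i * v i r z.
Proof.
by elim: s => [|i s IH]; rewrite ?big_nil // big_cons -IH.
Qed.

(* [K[d]_{<= N}] and [bar W_{mu + N}] have the same finite dimension, so that
   the surjection [g |-> g <> bar S] between them is injective. *)
Lemma Gr_inj W S mu (g : X -> K) (N : nat) :
  ord_le S mu -> regular S mu -> in_Gr mu W ->
  W = [set diamond f S | f in @in_F K m n] ->
  (forall t, g t != 0 -> (deg t <= N)%N) ->
  (forall l, fsum (fun t => g t * mat S t l 0) = 0) -> forall t, g t = 0.
Proof.
move=> Smu regS [_ HW] WE gN gS.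
have [col col_inj col_cov] := enum_deg_le N.
have [v [Wv [indep _]]] := HW N%:Z.
have fsum_col (F : X -> K) : (forall t, F t != 0 -> (deg t <= N)%N) ->
    fsum F = \sum_c F (col c).
  move=> FN; rewrite (fsum_inj (h := col)) ?fsum_finType //.
  by move=> t /FN /col_cov.
have /choice[f Hf] : forall i, exists f, [/\ in_F f, ord_le f N%:Z &
    v i = opbar (diamond f S)].
  move=> i; have [w [+ wN] vw] := Wv i; rewrite WE => -[f Ff fw].
  exists f; split=> //; last by rewrite fw vw.
  by apply: regular_ord regS Ff _; rewrite ?fw.
(* Row [i] holds the coefficients at [y = 0] of the preimage [f i] of the basis vector [v i]. By
   [regular_ord] they sit in degrees at most [N], so the matrix is square. *)
pose A : 'M[K]_('C(n + N, n)) := \matrix_(i, c) f i (zi (col c)) (0, 0).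
have vE i r z : v i r z = (z == 0)%:R * \sum_c A i c * mat S (col c) r 0.
  have [Ff fN ->] := Hf i; case: z => e j; rewrite /opbar /= ffun_cst0 xpair_eqE.
  have [->|e0] := eqVneq e 0; last by rewrite mul0r.
  have [->|j0] := eqVneq j 0; last by rewrite diamond_neq0 // mul0r.
  rewrite mul1r diamondE // /act (@fsum_col).
    apply: eq_bigr => c _; rewrite mxE /conv (@fsum_single _ _ (0, 0)).
      by rewrite addr0 eqxx mul1r.
    move=> [u v'] uv; have [/eqP E|_] := eqVneq (u + v') 0; last by rewrite mul0r.
    by move: uv; rewrite xpair_eqE; move: E; rewrite -deg_eq0 degD addn_eq0 !deg_eq0 => ->.
  move=> t /conv_neq0[[u v'] /= [/eqP + ft _]].
  rewrite -deg_eq0 degD addn_eq0 => /andP[/eqP u0 _].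
  by have := fN _ _ ft; rewrite absk_zi degmE /= u0 deg0; lia.
have comb (c : 'rV[K]_('C(n + N, n))) (r : Z) : \sum_i c 0 i * (\sum_x A i x * mat S (col x) r 0)
    = \sum_x (c *m A) 0 x * mat S (col x) r 0.
  under eq_bigr do rewrite mulr_sumr; rewrite exchange_big; apply: eq_bigr => x _.
  by rewrite mxE mulr_suml; apply: eq_bigr => i _; rewrite mulrA.
have lin0 (c : 'rV[K]_('C(n + N, n))) :
    (forall r, \sum_x (c *m A) 0 x * mat S (col x) r 0 = 0) -> c = 0.
  move=> c0; apply/rowP => i; rewrite mxE; move: i; apply: indep.
  apply/funext => r; apply/funext => z; rewrite foldr_opaddE big_enum /=.
  under eq_bigr do rewrite vE mulrCA; rewrite -mulr_sumr comb c0 mulr0 //.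
have uA : A \in unitmx.
  rewrite -row_free_unit -kermx_eq0; apply/eqP/row_matrixP => i; rewrite row0.
  apply: lin0 => r; rewrite -row_mul mulmx_ker row0.
  by apply: big1 => x _; rewrite mxE mul0r.
pose G : 'rV[K]_('C(n + N, n)) := \row_c g (col c).
(* The entries of [G *m invmx A] are the coordinates of [g <> bar S] in the basis [v], and this
   element is 0 by hypothesis. *)
have G0 : G *m invmx A = 0.
  apply: lin0 => r; rewrite mulmxKV // -[RHS](gS r) fsum_col.
    by apply: eq_bigr => x _; rewrite mxE.
  by move=> t; rewrite mulf_eq0 negb_or => /andP[/gN].
have {}G0 : G = 0 by rewrite -(mulmxKV uA G) G0 mul0mx.
move=> t; apply/eqP; apply: contraT => gt; have [c ct] := col_cov t (gN t gt).
by move/rowP/(_ c): G0; rewrite !mxE ct => /eqP; rewrite (negPf gt).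
Qed.

(** Induction on [deg e]. Once the coefficients of [h] of smaller degree in [y] vanish, the
    coefficient of [y^e] in [h <> S] is [h_e <> bar S], and [h_e] is a polynomial in [d] of degree
    at most [B + deg e], to which [Gr_inj] applies. *)
Lemma act_inj W S mu (h : X -> Y -> K) (B : nat) :
  ord_le S mu -> regular S mu -> in_Gr mu W ->
  W = [set diamond f S | f in @in_F K m n] ->
  (forall t u, h t u != 0 -> (deg t <= B + deg u)%N) ->
  (forall l e, act h S l e = 0) -> forall t e, h t e = 0.
Proof.
move=> Smu regS GrW WE hB hS t e; have [N] := ubnP (deg e).
elim: N => // N IH in t e *; rewrite ltnS => eN; move: t.
apply: (Gr_inj (N := (B + deg e)%N) Smu regS GrW WE) => [t /hB //|l].
rewrite -[RHS](hS l e); apply: eq_fsum => t.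
rewrite /conv (@fsum_single _ _ (e, 0)) /= ?addr0 ?eqxx ?mul1r //.
move=> [u v] ne; have [uv|_] := eqVneq (u + v) e; last by rewrite mul0r.
have v0 : v != 0 by apply: contraNneq ne => v0; rewrite -uv v0 addr0.
rewrite /= (IH t u) ?mul0r ?mulr0 //; apply: leq_trans eN.
by rewrite -uv degD -[ltnLHS]addn0 ltn_add2l lt0n deg_eq0.
Qed.

Lemma opmul_inj W S mu P Q : ord_le S mu -> regular S mu -> in_Gr mu W ->
  W = [set diamond f S | f in @in_F K m n] ->
  is_Dsym P -> is_Dsym Q -> opmul P S = opmul Q S -> P = Q.
Proof.
move=> Smu regS GrW WE DP DQ PQ; pose D := opadd P (opscale (-1) Q).
have DD : is_Dsym D by apply: Dsym_opadd => //; apply: Dsym_opscale.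
have [B DB] := matx_Dsym charK0 DD.
have D0 k t e : matx D k t e = 0.
  move: t e; apply: (act_inj (B := (B + deg k)%N) Smu regS GrW WE) => [t u /DB|l e].
    by lia.
  rewrite -[LHS]/(mmul (matx D) (mat S) k l e) -mat_opmul //.
  rewrite opmulDl // ?opmulZl //; last exact: Dsym_opscale.
  by rewrite mat_opadd mat_opscale PQ mulN1r subrr.
apply: (mat_inj charK0) => k l e; apply/eqP; rewrite -subr_eq0 -mulN1r.
rewrite -mat_opscale -mat_opadd -/D; apply: contraT => Dl.
have [t tl] := zi_surj ((Dsym_nonneg charK0 D).1 DD.1 _ _ _ Dl).
by move: Dl; rewrite -tl -/(matx D k t e) D0 eqxx.
Qed.

End Uniqueness.

(** * Leading terms by iterated maximisation *)

Section IteratedArgmax.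
Variables (I : eqType) (T : Type) (phi : I -> T -> int).

(** Lexicographic maximisation: each key in turn is maximised among the maximisers of the earlier
    ones. Attainment thus reduces to integers bounded above, without a well-order on the support. *)
Fixpoint argmax (D : T -> Prop) (s : seq I) : T -> Prop :=
  if s is i :: s' then
    argmax (fun x => D x /\ forall x', D x' -> phi i x' <= phi i x) s'
  else D.

Lemma argmax_sub (D : T -> Prop) s x : argmax D s x -> D x.
Proof. by elim: s D => [|i s IH] D //= /IH[]. Qed.

Lemma argmax_head (D : T -> Prop) i s x : argmax D (i :: s) x ->
  forall x', D x' -> phi i x' <= phi i x.
Proof. by move=> /= /argmax_sub[]. Qed.

Lemma argmax_ex (D : T -> Prop) s : (exists x, D x) ->
  (forall i, exists B, forall x, D x -> phi i x <= B) -> exists x, argmax D s x.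
Proof.
elim: s D => [|i s IH] D //= [x0 Dx0] bD; apply: IH; last first.
  by move=> j; have [B DB] := bD j; exists B => x [/DB].
have [B DB] := bD i.
have [d [x Dx <-] dmax] : exists2 d, (exists2 x, D x & phi i x = d) &
    forall d', (exists2 x, D x & phi i x = d') -> d' <= d.
  apply: (@int_max (fun d => exists2 x, D x & phi i x = d) (phi i x0) B).
    by exists x0.
  by move=> _ [x Dx <-]; apply: DB.
by exists x; split=> // x' Dx'; apply: dmax; exists x'.
Qed.

(** The reason why leading terms do not cancel in a product: a sum of two keys reaches the sum of
    their maxima only if each is maximal. Then [x'] and [y'] are again among the maximisers, and the
    next key is treated in the same way. *)
Lemma argmax_uniq (D E : T -> Prop) s x y x' y' :
  argmax D s x -> argmax E s y -> D x' -> E y' ->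
  (forall i, phi i x' + phi i y' = phi i x + phi i y) ->
  forall i, i \in s -> phi i x' = phi i x.
Proof.
elim: s D E => [|i s IH] D E //= mx my Dx' Ey' add j.
have [[Dx xmax] [Ey ymax]] := (argmax_sub mx, argmax_sub my).
have [ex ey] : phi i x' = phi i x /\ phi i y' = phi i y.
  by have := xmax _ Dx'; have := ymax _ Ey'; have := add i; lia.
rewrite inE => /orP[/eqP -> //|]; apply: IH mx my _ _ add j.
  by split=> // z Dz; rewrite ex; apply: xmax.
by split=> // z Ez; rewrite ey; apply: ymax.
Qed.

End IteratedArgmax.

(** * The order of [S o f], and existence of [L_S(f)] *)

Section Existence.
Variables (K : fieldType) (m n : nat).
Hypothesis charK0 : [pchar K] =i pred0.
Local Notation X := {ffun 'I_n -> nat}.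
Local Notation Z := {ffun 'I_n -> int}.
Local Notation Y := {ffun 'I_m -> nat}.
Local Notation op := (op K m n).
Implicit Types (P Q S f g : op) (k j a b p t : X) (l r : Z) (e u v : Y).

Lemma addz_ord l r (i : 'I_n) : (l + r) i = l i + r i.
Proof. by rewrite ffunE. Qed.

(* Each of these functionals is bounded above on the support of an element of
   [hat Pi_n] with fixed [x]-exponent, and together they separate points. *)
Definition lead_key (i : option ('I_m + 'I_n)) (x : Z * Y) : int :=
  match i with
  | None => absk x.1 - (deg x.2)%:Z
  | Some (inl i) => - (x.2 i)%:Z
  | Some (inr i) => if is_last i then 0 else - x.1 i
  end.

(** The keys give the [y]-exponent, hence [absk], and all coordinates but the last; the last one is
    then the difference. *)
Lemma lead_key_sep x y : (forall i, lead_key i x = lead_key i y) -> x = y.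
Proof.
case: x y => [k u] [l v] /= H.
have uv : u = v by apply/ffunP => i; have /= := H (Some (inl i)); lia.
have kl : absk k = absk l by have /= := H None; rewrite uv; lia.
have nl i : ~~ is_last i -> k i = l i.
  by move=> /negPf li; have /= := H (Some (inr i)); rewrite li => /oppr_inj.
congr (_, _) => //; apply/ffunP => i.
have [li|] := boolP (is_last i); last exact: nl.
move: kl; rewrite /absk (bigD1 i) //= [RHS](bigD1 i) //=.
rewrite (eq_bigr l) => [/addIr //|j ji]; apply: nl; apply: contraNN ji => lj.
by apply/eqP/val_inj/succn_inj; move: li lj => /eqP -> /eqP ->.
Qed.

Lemma ord_le_opmul_const_inv S f (mu B : int) : is_hatPi S -> in_VPi f ->
  ~ ord_le S (mu - 1) -> ord_le (opmul S f) (mu + B) -> ord_le f B.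
Proof.
move=> PS Vf nS SfB; apply: contrapT => nf.
(* A term of [S] of order at least [mu] fixes the [x]-exponent [a] for the whole proof, as right
   multiplication by [f] does not change it. *)
have [k0 [u0 [a [S0 gt0]]]] : exists (k : Z) u a, S k (u, a) != 0 /\
    mu + (deg a)%:Z <= absk k - (deg u)%:Z.
  apply: contrapT => H; apply: nS => k [u a] Sk; rewrite leNgt; apply/negP => lt.
  by apply: H; exists k, u, a; split=> //; move: lt; rewrite degmE /=; lia.
have [k1 [u1 [f1 gt1]]] : exists (k : Z) u, f k (u, 0) != 0 /\ B < absk k - (deg u)%:Z.
  apply: contrapT => H; apply: nf => k [u j] fk; rewrite leNgt; apply/negP => lt.
  have j0 := const_coef0 Vf.2 fk; subst j; apply: H; exists k, u; split=> //.
  by move: lt; rewrite degmE /= deg0; lia.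
have bounded (P : op) (c : X) : is_hatPi P ->
    forall i, exists C, forall x, P x.1 (x.2, c) != 0 -> lead_key i x <= C.
  move=> [P0 [C PC]] [[i|i]|].
  - by exists 0 => x _ /=; lia.
  - exists 0 => -[k u] /= Pk; case: ifPn => // li; rewrite oppr_le0 leNgt.
    by apply/negP => ki; move: Pk; rewrite P0 ?eqxx //; exists i.
  - by exists (C + (deg c)%:Z) => -[k u] /= /PC; rewrite degmE /=; lia.
(* The order key comes first, so the leading terms have order at least that of the terms [(k0, u0)]
   and [(k1, u1)]. *)
pose s := None :: [seq Some i | i <- enum {: 'I_m + 'I_n}].
have alls i : i \in s.
  by rewrite inE; case: i => [i|] //=; rewrite map_f // mem_enum.
have [x xmax] := @argmax_ex _ _ lead_key (fun x => S x.1 (x.2, a) != 0) s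
  (ex_intro _ (k0, u0) S0) (bounded S a PS).
have [y ymax] := @argmax_ex _ _ lead_key (fun y => f y.1 (y.2, 0) != 0) s
  (ex_intro _ (k1, u1) f1) (bounded f 0 Vf.1.1).
have Sx := argmax_sub xmax; have fy := argmax_sub ymax.
(* All keys are additive, so [argmax_uniq] leaves [(x, y)] as the only pair of terms contributing to
   this coefficient of [S o f]. *)
have uniq (p : Z) u v : u + v = x.2 + y.2 -> S p (u, a) != 0 ->
    f (x.1 + y.1 - p) (v, 0) != 0 -> (p, u) = x.
  move=> uv Sp fp; apply: lead_key_sep => i.
  apply: (@argmax_uniq _ _ lead_key _ _ s x y (p, u) (x.1 + y.1 - p, v)
    xmax ymax Sp fp _ i (alls i)) => {i}.
  case=> [[c|c]|] /=.
  - by have := congr1 (fun w : Y => w c) uv; rewrite !addx_ord; lia.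
  - by case: ifP => // _; rewrite subzE addz_ord; lia.
  - by have := congr1 (@deg _) uv; rewrite !degD !abskD abskN; lia.
have val : opmul S f (x.1 + y.1) (x.2 + y.2, a) = S x.1 (x.2, a) * f y.1 (y.2, 0).
  rewrite opmul_const //; last exact: Vf.2.
  rewrite (@fsum_single _ _ x.1).
    rewrite [_ + y.1]addrC addrK /conv (@fsum_single _ _ (x.2, y.2)).
      by rewrite eqxx mul1r.
    move=> [u v] ne; apply/eqP; apply: contraNT ne.
    rewrite !mulf_eq0 !negb_or natb_neq0 => /and3P[/eqP /= uv Su fv].
    have xE : (x.1, u) = x by apply: uniq uv Su _; rewrite [_ + y.1]addrC addrK.
    have ux : u = x.2 by rewrite -[in RHS]xE.
    by move: uv; rewrite ux addrC [RHS]addrC => /addxI ->.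
  move=> p px; apply/eqP; apply: contraNT px => /conv_neq0[[u v] /= [uv Su fv]].
  by rewrite -(uniq p u v).
have /SfB : opmul S f (x.1 + y.1) (x.2 + y.2, a) != 0 by rewrite val mulf_neq0.
have := argmax_head xmax (x' := (k0, u0)) S0.
have := argmax_head ymax (x' := (k1, u1)) f1.
by rewrite /= abskD degmE /= degD; lia.
Qed.

Lemma Sato_exists W S mu f : is_hatPi S -> ord_le S mu -> regular S mu ->
  W = [set diamond f S | f in @in_F K m n] -> (forall w, W w -> in_VPi w) ->
  in_VPi f -> (forall w, W w -> W (opmul w f)) ->
  exists L, [/\ is_Dsym L, opmul S f = opmul L S & forall B, ord_le f B -> ord_le L B].
Proof.
move=> PS Smu regS WE WV Vf Wf; pose w k := diamond (@dmon K m n k) S.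
have Ww k : W (w k) by rewrite WE; exists (@dmon K m n k) => //; apply: in_F_dmon.
have wE k r e : w k r (e, 0) = mat S k r e.
  by rewrite /w diamondE ?act_delta //; apply: in_F_dmon.
have /choice[h Hh] : forall k, exists h, in_F h /\ diamond h S = opmul (w k) f.
  by move=> k; have := Wf _ (Ww k); rewrite {1}WE => -[h Fh hE]; exists h.
(* The [h k] are chosen independently of each other; surjectivity of [mat] alone assembles them into
   one operator. *)
have [L LE] := mat_surj charK0 (fun k l e => h k l (e, 0)).
have Lord B : ord_le f B -> ord_le L B.
  move=> fB; apply/(ord_le_mat charK0) => k l e; rewrite LE => hk.
  have [Fh hE] := Hh k.
  have hB : ord_le (h k) (B + (deg k)%:Z).
    apply: (regular_ord charK0 Smu regS Fh); rewrite hE.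
    (* [w k], row [k] of [S], has order at most [mu + deg k]. Multiplying by [f] adds [B], and
       [regular_ord] removes [mu]. *)
    have -> : mu + (B + (deg k)%:Z) = mu + (deg k)%:Z + B by lia.
    have Vw := WV _ (Ww k); apply: ord_le_opmul_const => //; first exact: Vw.1.1.
    move=> r [u j] wr; have j0 := const_coef0 Vw.2 wr; subst j; move: wr.
    rewrite wE => /((ord_le_mat charK0 S mu).1 Smu); rewrite degmE /= deg0; lia.
  by have := hB _ _ hk; rewrite degmE /= deg0; lia.
have DL : is_Dsym L.
  have [[[_ [B fB]] _] _] := Vf; split; last by exists B; apply: Lord.
  apply/(Dsym_nonneg charK0) => k l e; rewrite LE => hk i; rewrite leNgt.
  by apply/negP => li; move: hk; rewrite (Hh k).1.2 ?eqxx //; exists i.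
exists L; split=> //; apply: (mat_inj charK0) => k l e.
rewrite [RHS]mat_opmul // mat_opmul_const //; have [Fh hE] := Hh k.
transitivity (diamond (h k) S l (e, 0)); last first.
  by rewrite diamondE //; apply: eq_fsum => t; apply: eq_conv => // u; rewrite /matx LE.
rewrite hE -mat0 mat_opmul_const //; last exact: (WV _ (Ww k)).1.1.
by apply: eq_fsum => r; apply: eq_conv => // u; rewrite mat0 wE.
Qed.

End Existence.

Theorem mainTheorem12 (K : fieldType) (m n : nat)
  (charK0 : [pchar K] =i pred0) (n_gt0 : (0 < n)%N)
  (A W : op K m n -> Prop) (S : op K m n) :
  schur_pair A W -> sato W S ->
  exists L : op K m n -> op K m n,
    (* (1) *)
    (forall f, A f ->
       is_Dsym (L f) /\ opmul S f = opmul (L f) S /\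
       (forall B, ord_le (L f) B <-> ord_le f B) /\
       (forall P, is_Dsym P -> opmul S f = opmul P S -> P = L f)) /\
    (* (2) injective K-algebra homomorphism A -> \hat D_n^sym *)
    (forall f g, A f -> A g -> L f = L g -> f = g) /\
    L (@opone K m n) = @opone K m n /\
    (forall f g, A f -> A g -> L (opadd f g) = opadd (L f) (L g)) /\
    (forall (c : K) f, A f -> L (opscale c f) = opscale c (L f)) /\
    (forall f g, A f -> A g -> L (opmul f g) = opmul (L f) (L g)).
Proof.
move=> [[AV _] [[WV _] [[A1 [AD [AZ AM]]] [WA _]]]].
move=> [mu [GrW [PS [[Smu nSmu] [regS WE]]]]].
(* Outside [A] the value of [L] is a dummy, namely [f] itself. *)
have /choice[L HL] : forall f, exists L, A f -> [/\ is_Dsym L,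
    opmul S f = opmul L S & forall B, ord_le f B -> ord_le L B].
  move=> f; have [Af|nAf] := pselect (A f); last by exists f => /nAf.
  have [L HL] := Sato_exists charK0 PS Smu regS WE WV (AV f Af) (fun w Ww => WA w f Ww Af).
  by exists L.
have DL f : A f -> is_Dsym (L f) by case/HL.
have EL f : A f -> opmul S f = opmul (L f) S by case/HL.
have UL P f : is_Dsym P -> A f -> opmul S f = opmul P S -> P = L f.
  move=> DP Af E; apply: (opmul_inj charK0 Smu regS GrW WE DP (DL f Af)).
  by rewrite -E EL.
(* [S o f = L f o S] has order at most [mu + B] while [S] has order exactly [mu]. Equality of orders
   is expressed through all upper bounds, which covers the zero operator. *)
have OL f B : A f -> ord_le (L f) B -> ord_le f B.
  move=> Af LB; apply: (ord_le_opmul_const_inv PS (AV f Af) nSmu).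
  by rewrite EL // [mu + B]addrC; apply: ord_le_opmul => //; apply: DL.
have LD f g : A f -> A g -> L (opadd f g) = opadd (L f) (L g).
  move=> Af Ag; apply/esym/UL; [|exact: AD|].
    by apply: Dsym_opadd => //; apply: DL.
  rewrite opmulDr ?opmulDl ?EL //; by [apply: DL | apply: AV | apply/AV/AD].
have LZ c f : A f -> L (opscale c f) = opscale c (L f).
  move=> Af; apply/esym/UL; [|exact: AZ|].
    by apply: Dsym_opscale => //; apply: DL.
  rewrite opmulZr ?opmulZl ?EL //; by [apply: DL | apply: AV | apply/AV/AZ].
exists L; split.
  move=> f Af; split; first exact: DL.
  split; first exact: EL.
  split; last by move=> P DP; apply: UL.
  by move=> B; split; [apply: OL | case: (HL f Af) => _ _; apply].
split.
  move=> f g Af Ag LE; pose d := opadd f (opscale (-1) g).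
  have Ad : A d by apply: AD => //; apply: AZ.
  have Ld r z : L d r z = 0.
    by rewrite LD ?LZ ?LE //; [rewrite /opadd /opscale mulN1r subrr | apply: AZ].
  apply/funext => r; apply/funext => z; apply/eqP; rewrite -subr_eq0.
  (* [L d = 0] satisfies every order bound, hence so does [d]; a bound one below the order of a
     nonzero term of [d] is contradictory. *)
  apply: contraT => fg; have := @OL d (absk r - (degm z)%:Z - 1) Ad _ r z.
  rewrite /d /opadd /opscale mulN1r => /(_ _ fg) H.
  suff : absk r - (degm z)%:Z <= absk r - (degm z)%:Z - 1 by lia.
  by apply: H => r' z'; rewrite Ld eqxx.
split; first by apply/esym/UL => //; [exact: Dsym_opone | rewrite opmul1r // opmul1l].
split=> //; split=> // f g Af Ag; apply/esym/UL; [|exact: AM|].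
  by apply: Dsym_opmul => //; apply: DL.
(* [S o (f o g) = (S o f) o g = L f o (S o g) = (L f o L g) o S], each step using the associativity
   law for its own kind of triple. *)
rewrite opmulA_const2 //; try by [apply: AV | apply/AV/AM].
rewrite EL // -opmulA_const //; try by [apply: DL | apply: AV].
by rewrite EL // opmulA //; apply: DL.
Qed.
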